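(* Let $\mathbb{T} = \mathbb{R}^2 / 2\pi\mathbb{Z}^2$ be the flat torus with coordinates $(x,y)$, and let $\alpha, \beta \in \mathbb{R}$ with $\alpha/\beta$ irrational. Let $X$ be the vector field on $\mathbb{T}$ whose flow is the irrational winding $\psi_t(x,y) = (x + \alpha t, y + \beta t)$. Let $G: \mathbb{T} \to \mathbb{R}$ be smooth with Fourier expansion \[G(x,y) = \sum_{(n,m) \in \mathbb{Z}^2} \hat{G}(n,m) \exp(i(nx + my)),\] and let $\operatorname{Supp}\hat{G} = \{(n,m) \in \mathbb{Z}^2 : \hat{G}(n,m) \neq 0\}$. Then $G$ is a good observation for $X$ if and only if $\operatorname{Supp}\hat{G}$ generates $\mathbb{Z}^2$ as an abelian group.
   Context: $\hat{G}(n,m) \in \mathbb{C}$ denotes the $(n,m)$-th Fourier coefficient of $G$. For a smooth function $G$ on a compact manifold $M$ and a vector field $X$ with flow $\psi_t$, the Takens map $\Psi^N_\tau: M \to \mathbb{R}^{N+1}$ is $\Psi^N_\tau(p) = (G(p), G(\psi_\tau(p)), G(\psi_{2\tau}(p)), \ldots, G(\psi_{N\tau}(p)))$; $G$ is called a good observation for $X$ if there exist an integer $N > 0$ and $\tau > 0$ such that $\Psi^N_\tau$ is a (smooth) embedding. *)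

(* Defs.v *)
From Stdlib Require Import Reals ZArith List.
From Coquelicot Require Import Coquelicot.
Open Scope R_scope.

(* A function on the flat torus T = R^2 / 2piZ^2 is represented by its lift,
   a function R -> R -> R that is 2pi-periodic in each variable. *)
Definition torus_fun (G : R -> R -> R) : Prop :=
  forall x y, G (x + 2 * PI) y = G x y /\ G x (y + 2 * PI) = G x y.

Definition dx (f : R -> R -> R) : R -> R -> R :=
  fun x y => Derive (fun t => f t y) x.
Definition dy (f : R -> R -> R) : R -> R -> R :=
  fun x y => Derive (fun t => f x t) y.

Fixpoint Ck (k : nat) (f : R -> R -> R) : Prop :=
  match k with
  | O => forall p : R * R,
           continuous (fun q : R * R => f (fst q) (snd q)) p
  | S k' => (forall p : R * R,
               continuous (fun q : R * R => f (fst q) (snd q)) p)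
            /\ (forall x y, ex_derive (fun t => f t y) x
                            /\ ex_derive (fun t => f x t) y)
            /\ Ck k' (dx f) /\ Ck k' (dy f)
  end.

Definition smooth2 (f : R -> R -> R) : Prop := forall k, Ck k f.

Definition smooth_torus_fun (G : R -> R -> R) : Prop :=
  torus_fun G /\ smooth2 G.

Definition flow (alpha beta t : R) (p : R * R) : R * R :=
  (fst p + alpha * t, snd p + beta * t).

(* The Takens map Psi^N_tau (lifted to R^2); component k in {0..N}. *)
Definition takens (G : R -> R -> R) (alpha beta : R) (N : nat) (tau : R)
  (p : R * R) (k : nat) : R :=
  let q := flow alpha beta (INR k * tau) p in G (fst q) (snd q).

Definition torus_eq (p q : R * R) : Prop :=
  exists z1 z2 : Z, fst q = fst p + 2 * PI * IZR z1
                 /\ snd q = snd p + 2 * PI * IZR z2.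

(* Smooth embedding T -> R^{N+1} of the map induced by a (smooth, periodic)
   lift F : R^2 -> R^{N+1} (components k = 0..N):
   - injective on the torus,
   - immersion: the differential (columns dF/dx, dF/dy) is injective,
   - homeomorphism onto its image (sequential form; the torus is a
     metric quotient of R^2). *)
Definition torus_smooth_embedding (N : nat) (F : R * R -> nat -> R) : Prop :=
  (forall p q, (forall k, (k <= N)%nat -> F p k = F q k) -> torus_eq p q)
  /\ (forall p : R * R, forall a b : R,
        (forall k, (k <= N)%nat ->
           a * Derive (fun t => F (t, snd p) k) (fst p)
           + b * Derive (fun t => F (fst p, t) k) (snd p) = 0) ->
        a = 0 /\ b = 0)
  /\ (forall (ps : nat -> R * R) (p : R * R),
        (forall k, (k <= N)%nat -> is_lim_seq (fun j => F (ps j) k) (F p k)) ->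
        exists z : nat -> Z * Z,
          is_lim_seq (fun j => fst (ps j) + 2 * PI * IZR (fst (z j))) (fst p)
          /\ is_lim_seq (fun j => snd (ps j) + 2 * PI * IZR (snd (z j))) (snd p)).

Definition good_observation (G : R -> R -> R) (alpha beta : R) : Prop :=
  exists (N : nat) (tau : R), (0 < N)%nat /\ 0 < tau /\
    torus_smooth_embedding N (takens G alpha beta N tau).

Definition fourier_coef (G : R -> R -> R) (n m : Z) : C :=
  scal (/ (4 * PI ^ 2))
    (RInt (V := C_R_CompleteNormedModule)
       (fun x => RInt (V := C_R_CompleteNormedModule)
          (fun y => scal (G x y)
             ((cos (IZR n * x + IZR m * y), - sin (IZR n * x + IZR m * y)) : C))
          0 (2 * PI))
       0 (2 * PI)).

Definition fourier_support (G : R -> R -> R) (nm : Z * Z) : Prop :=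
  fourier_coef G (fst nm) (snd nm) <> (0 : C).

Definition generates_Z2 (S : Z * Z -> Prop) : Prop :=
  forall v : Z * Z, exists l : list (Z * (Z * Z)),
    (forall c g, In (c, g) l -> S g) /\
    fold_right (fun cg acc => (fst acc + fst cg * fst (snd cg),
                               snd acc + fst cg * snd (snd cg))%Z) (0%Z, 0%Z) l
    = v.

Definition ratio_irrational (alpha beta : R) : Prop :=
  beta <> 0 /\ forall p q : Z, q <> 0%Z -> alpha / beta <> IZR p / IZR q.

(* Main.v *)
(* A translation vector [w] is a period of [G] iff [<k, w>] lies in [2 PI Z]
   for every [k] in the support, so the support generates [Z^2] iff [G] has no
   period outside [2 PI Z^2].  A period identifies two points under every
   Takens map, so an embedding excludes nontrivial periods.  Conversely choose
   [tau] such that the orbit of the time-[tau] map equidistributes.  If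
   [G (p + .)] and [G (q + .)] agree along this orbit, they agree everywhere
   and [q - p] is a period; if [u . grad G] vanishes along it, all multiples of
   [u] are periods, so [u = 0].  By compactness finitely many times suffice: a
   sequence of pairs violating injectivity for larger and larger [N] converges
   either to such a pair [p <> q] or, on the diagonal, to such a direction
   [u <> 0].  Fourier uniqueness and the vanishing along an orbit both come from
   testing against a product of Fejer kernels. *)
Require Import Defs.
From Stdlib Require Import Reals ZArith List.
From Stdlib Require Import Lra Lia Psatz Classical ClassicalEpsilon Zfloor Cantor.
From Coquelicot Require Import Coquelicot.
Open Scope R_scope.

(** Both uses of the Fejer kernels rest on one inequality: if [H] is positive somewhere, there are
    trigonometric polynomials [T] and [T'] with [T' <= H * T] and [T'] of positive mean. Any
    averaging that sends trigonometric polynomials to their means and kills [H * T] then gives a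
    contradiction. Integration over the torus and averages along a nonresonant orbit are two such
    averagings. The obstacle to passing to finitely many times is the diagonal: two points violating
    injectivity may merge, and their common limit says nothing. Their differences are therefore
    rescaled to unit length. The mean value theorem turns them into directions killed by the
    derivatives, taken at points that may differ for the two partial derivatives but lie within a
    vanishing distance of the orbit. Failure of the immersion condition is the same situation with
    distance zero, so one compactness lemma serves both. Everything trigonometric is kept real, as
    cosines with a phase; a translation then acts on Fourier coefficients by shifting the phase. *)

Lemma nat_choice (A : Type) (P : nat -> A -> Prop) :
  (forall n, exists a, P n a) -> exists f, forall n, P n (f n).
Proof.
  intros H. exists (fun n => proj1_sig (constructive_indefinite_description _ (H n))).
  intros n. now destruct constructive_indefinite_description.
Qed.

(** * Continuity of functions of two variables *)

Definition cont2 (f : R -> R -> R) : Prop := forall x y, continuity_2d_pt f x y.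

Lemma cont2_comp (h : R -> R) (g : R -> R -> R) :
  continuity h -> cont2 g -> cont2 (fun x y => h (g x y)).
Proof. intros Hh Hg x y. apply continuity_1d_2d_pt_comp; auto. Qed.

Lemma cont2_plus f g : cont2 f -> cont2 g -> cont2 (fun x y => f x y + g x y).
Proof. intros Hf Hg x y. now apply continuity_2d_pt_plus. Qed.

Lemma cont2_mult f g : cont2 f -> cont2 g -> cont2 (fun x y => f x y * g x y).
Proof. intros Hf Hg x y. now apply continuity_2d_pt_mult. Qed.

Lemma cont2_const c : cont2 (fun _ _ => c).
Proof. intros x y. apply continuity_2d_pt_const. Qed.

Lemma cont2_ext f g : (forall x y, f x y = g x y) -> cont2 f -> cont2 g.
Proof. intros E Hf x y. now apply (continuity_2d_pt_ext f). Qed.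

Lemma cont2_affine a b c : cont2 (fun x y => a * x + b * y + c).
Proof.
  apply (cont2_plus (fun x y => a * x + b * y)); [|apply cont2_const].
  apply (cont2_plus (fun x y => a * x) (fun x y => b * y));
    apply (cont2_mult (fun _ _ => _)); try apply cont2_const.
  - intros x y; apply continuity_2d_pt_id1.
  - intros x y; apply continuity_2d_pt_id2.
Qed.

Lemma cont2_cos a b c : cont2 (fun x y => cos (a * x + b * y + c)).
Proof. apply (cont2_comp cos); [apply continuity_cos | apply cont2_affine]. Qed.

Lemma cont2_shift f u v : cont2 f -> cont2 (fun x y => f (x + u) (y + v)).
Proof.
  intros Hf x y eps. destruct (Hf (x + u) (y + v) eps) as [d Hd].
  exists d. intros x' y' Hx Hy. apply Hd.
  - replace (x' + u - (x + u)) with (x' - x) by ring; exact Hx.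
  - replace (y' + v - (y + v)) with (y' - y) by ring; exact Hy.
Qed.

Lemma cont2_is_lim_seq f (u v : nat -> R) (x y : R) :
  cont2 f -> is_lim_seq u x -> is_lim_seq v y ->
  is_lim_seq (fun n => f (u n) (v n)) (f x y).
Proof.
  intros Hf Hu Hv. apply is_lim_seq_spec. intros eps.
  destruct (Hf x y eps) as [d Hd].
  apply is_lim_seq_spec in Hu. apply is_lim_seq_spec in Hv.
  destruct (Hu d) as [N1 H1]. destruct (Hv d) as [N2 H2].
  exists (N1 + N2)%nat. intros n Hn. apply Hd; [apply H1 | apply H2]; lia.
Qed.

(** * Extraction of convergent subsequences *)

Definition extraction (phi : nat -> nat) : Prop :=
  forall n, (phi n < phi (S n))%nat.

Lemma extraction_ge phi : extraction phi -> forall n, (n <= phi n)%nat.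
Proof.
  intros H n. induction n as [|n IH]; [lia|]. specialize (H n). lia.
Qed.

Lemma extraction_filterlim phi :
  extraction phi -> filterlim phi eventually eventually.
Proof.
  intros H P [N HN]. exists N. intros n Hn. apply HN.
  pose proof (extraction_ge phi H n). lia.
Qed.

Lemma extraction_lt phi : extraction phi ->
  forall a b, (a < b)%nat -> (phi a < phi b)%nat.
Proof.
  intros H a b Hab. induction Hab as [|b Hab IH]; [apply H|].
  specialize (H b). lia.
Qed.

Lemma extraction_comp phi psi :
  extraction phi -> extraction psi -> extraction (fun n => phi (psi n)).
Proof. intros H1 H2 n. apply extraction_lt; auto. Qed.

Lemma is_lim_seq_extract u (l : Rbar) phi :
  extraction phi -> is_lim_seq u l -> is_lim_seq (fun n => u (phi n)) l.
Proof. intros H. apply is_lim_seq_subseq. now apply extraction_filterlim. Qed.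

Lemma bounded_extract (u : nat -> R) (M : R) :
  (forall n, Rabs (u n) <= M) ->
  exists phi (l : R), extraction phi /\ is_lim_seq (fun n => u (phi n)) l.
Proof.
  intros Hu.
  destruct (Bolzano_Weierstrass u (fun c => - M <= c <= M)) as [l Hl].
  { apply compact_P3. }
  { intros n. specialize (Hu n). apply Rabs_le_between in Hu. exact Hu. }
  assert (E : forall N k : nat, exists p, (N <= p)%nat /\ Rabs (u p - l) < / (INR k + 1)).
  { intros N k.
    assert (P : 0 < / (INR k + 1)) by (apply Rinv_0_lt_compat; pose proof (pos_INR k); lra).
    destruct (Hl (disc l (mkposreal _ P)) N) as [p Hp].
    { exists (mkposreal _ P). intros x Hx. exact Hx. }
    exists p. exact Hp. }
  destruct (nat_choice _ _ (fun N => nat_choice _ _ (E N))) as [next Hnext].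
  (* [next N k] is an index at least [N] whose value lies within [1 / (k + 1)] of [l]. Searching
     from [S (phi k)] makes [phi] strictly increasing. *)
  pose (phi := fix phi (n : nat) : nat :=
    match n with O => next O O | S k => next (S (phi k)) (S k) end).
  exists phi, l. split.
  - intros n. simpl. destruct (Hnext (S (phi n)) (S n)). lia.
  - assert (B : forall n, Rabs (u (phi n) - l) < / (INR n + 1)).
    { intros [|n]; simpl phi; apply Hnext. }
    apply is_lim_seq_spec. intros eps.
    destruct (nfloor_ex (/ eps)) as [N HN].
    { left. apply Rinv_0_lt_compat, cond_pos. }
    exists N. intros n Hn. eapply Rlt_le_trans; [apply B|].
    rewrite <- (Rinv_inv eps). apply Rinv_le_contravar.
    + apply Rinv_0_lt_compat, cond_pos.
    + apply le_INR in Hn. lra.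
Qed.

Lemma bounded_extract2 (u v : nat -> R) (M : R) :
  (forall n, Rabs (u n) <= M) -> (forall n, Rabs (v n) <= M) ->
  exists phi (l l' : R), extraction phi /\
    is_lim_seq (fun n => u (phi n)) l /\ is_lim_seq (fun n => v (phi n)) l'.
Proof.
  intros Hu Hv.
  destruct (bounded_extract u M Hu) as [phi [l [E1 L1]]].
  destruct (bounded_extract (fun n => v (phi n)) M) as [psi [l' [E2 L2]]].
  { intros n; apply Hv. }
  exists (fun n => phi (psi n)), l, l'. repeat split; auto.
  - now apply extraction_comp.
  - apply (is_lim_seq_extract (fun n => u (phi n))); auto.
Qed.

(** * Reduction modulo [2 * PI] and compactness of the torus *)

Lemma mod_2PI (x : R) : exists z : Z, Rabs (x + 2 * PI * IZR z) <= PI.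
Proof.
  pose proof PI_RGT_0 as HP.
  exists (- Zfloor ((x + PI) / (2 * PI)))%Z.
  rewrite opp_IZR. destruct (Zfloor_bound ((x + PI) / (2 * PI))) as [H1 H2].
  set (f := IZR (Zfloor _)) in *.
  apply (Rmult_le_compat_r (2 * PI)) in H1; [|lra].
  apply (Rmult_lt_compat_r (2 * PI)) in H2; [|lra].
  replace ((x + PI) / (2 * PI) * (2 * PI)) with (x + PI) in * by (field; lra).
  apply Rabs_le. lra.
Qed.

Lemma periodic_IZR (g : R -> R) (T : R) :
  (forall x, g (x + T) = g x) -> forall x z, g (x + T * IZR z) = g x.
Proof.
  intros H.
  assert (N : forall n x, g (x + T * INR n) = g x).
  { induction n as [|n IH]; intros x.
    - simpl. f_equal; ring.
    - rewrite S_INR. replace (x + T * (INR n + 1)) with (x + T * INR n + T) by ring.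
      now rewrite H, IH. }
  intros x z. destruct (Z_le_gt_dec 0 z) as [Hz|Hz].
  - rewrite <- (Z2Nat.id z Hz), <- INR_IZR_INZ. apply N.
  - rewrite <- (N (Z.to_nat (- z)) (x + T * IZR z)). f_equal.
    rewrite INR_IZR_INZ, Z2Nat.id, opp_IZR by lia. ring.
Qed.

Lemma torus_fun_IZR G : torus_fun G -> forall x y z w,
  G (x + 2 * PI * IZR z) (y + 2 * PI * IZR w) = G x y.
Proof.
  intros H x y z w.
  rewrite (periodic_IZR (fun t => G t (y + 2 * PI * IZR w)) (2 * PI)) by (intros; apply H).
  apply (periodic_IZR (fun t => G x t)). intros; apply H.
Qed.

(** Otherwise there are points of the square [[-PI, PI]^2] with [Rabs G] above every [n], and
    continuity fails at the limit of a convergent subsequence. *)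
Lemma torus_fun_bounded G : torus_fun G -> cont2 G ->
  exists M, forall x y, Rabs (G x y) <= M.
Proof.
  intros HG HC. apply NNPP. intros Hn.
  assert (E : forall n : nat, exists p : R * R,
    (Rabs (fst p) <= PI /\ Rabs (snd p) <= PI) /\ INR n < Rabs (G (fst p) (snd p))).
  { intros n. apply NNPP. intros H. apply Hn. exists (INR n). intros x y.
    apply Rnot_lt_le. intros Hlt. apply H.
    destruct (mod_2PI x) as [z Hz]. destruct (mod_2PI y) as [w Hw].
    exists (x + 2 * PI * IZR z, y + 2 * PI * IZR w). simpl.
    rewrite torus_fun_IZR; auto. }
  apply nat_choice in E. destruct E as [p Hp].
  destruct (bounded_extract2 (fun n => fst (p n)) (fun n => snd (p n)) PI)
    as [phi [x [y [E1 [L1 L2]]]]]; try (intros n; apply Hp).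
  pose proof (cont2_is_lim_seq G _ _ x y HC L1 L2) as L.
  apply is_lim_seq_spec in L. destruct (L (mkposreal 1 Rlt_0_1)) as [N HN]. simpl in HN.
  destruct (nfloor_ex (Rabs (G x y) + 1)) as [k Hk].
  { pose proof (Rabs_pos (G x y)); lra. }
  pose (n := (N + S k)%nat).
  specialize (HN n ltac:(unfold n; lia)).
  destruct (Hp (phi n)) as [_ B].
  assert (INR (S k) <= INR (phi n)).
  { apply le_INR. pose proof (extraction_ge phi E1 n). unfold n in *; lia. }
  rewrite S_INR in H.
  pose proof (Rabs_triang_inv (G (fst (p (phi n))) (snd (p (phi n)))) (G x y)). lra.
Qed.

(** * Trigonometric polynomials and Fejer kernels *)

(* The second argument is the mean value. *)
Inductive trig_poly1 : (R -> R) -> R -> Prop :=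
| tp1_cos (n : Z) phi : n <> 0%Z -> trig_poly1 (fun x => cos (IZR n * x + phi)) 0
| tp1_const c : trig_poly1 (fun _ => c) c
| tp1_plus f g c d : trig_poly1 f c -> trig_poly1 g d ->
    trig_poly1 (fun x => f x + g x) (c + d)
| tp1_scal k f c : trig_poly1 f c -> trig_poly1 (fun x => k * f x) (k * c)
| tp1_ext f g c d : (forall x, f x = g x) -> c = d -> trig_poly1 f c -> trig_poly1 g d.

(** The phase covers sines as well as cosines, and [tp_ext] closes the class under pointwise
    equality. The mean is carried as an index so that integrals and orbit averages can be computed
    by induction. *)
Inductive trig_poly : (R -> R -> R) -> R -> Prop :=
| tp_cos (n m : Z) phi : (n, m) <> (0, 0)%Z ->
    trig_poly (fun x y => cos (IZR n * x + IZR m * y + phi)) 0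
| tp_const c : trig_poly (fun _ _ => c) c
| tp_plus f g c d : trig_poly f c -> trig_poly g d ->
    trig_poly (fun x y => f x y + g x y) (c + d)
| tp_scal k f c : trig_poly f c -> trig_poly (fun x y => k * f x y) (k * c)
| tp_ext f g c d : (forall x y, f x y = g x y) -> c = d -> trig_poly f c -> trig_poly g d.

Lemma trig_poly_cont f c : trig_poly f c -> cont2 f.
Proof.
  induction 1 as [n m phi _|c|f g c d _ Hf _ Hg|k f c _ Hf|f g c d E _ _ Hf].
  - apply cont2_cos.
  - apply cont2_const.
  - now apply cont2_plus.
  - apply (cont2_mult (fun _ _ => k)); [apply cont2_const|exact Hf].
  - now apply (cont2_ext f).
Qed.

Lemma cos_mult a b : cos a * cos b = / 2 * cos (a + b) + / 2 * cos (a - b).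
Proof. rewrite cos_plus, cos_minus. field. Qed.

(** Means multiply because the variables are separate: a frequency [n <> 0] in [x] combines with any
    [m] in [y] into the nonzero frequencies [(n, m)] and [(n, -m)], so only constant times constant
    contributes. *)
Lemma trig_poly1_mult f g c d :
  trig_poly1 f c -> trig_poly1 g d -> trig_poly (fun x y => f x * g y) (c * d).
Proof.
  intros Hf Hg.
  induction Hf as [n phi Hn|c|f1 f2 c1 c2 _ H1 _ H2|k f c _ H|f1 f2 c1 c2 E Ec _ H].
  - assert (N : forall k, (n, k) <> (0, 0)%Z) by congruence.
    induction Hg as [m psi Hm|e|g1 g2 e1 e2 _ H1 _ H2|k g e _ H|g1 g2 e1 e2 E Ee _ H].
    + eapply tp_ext; [| |apply (tp_plus _ _ _ _
        (tp_scal (/2) _ _ (tp_cos n m (phi + psi) (N m)))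
        (tp_scal (/2) _ _ (tp_cos n (- m) (phi - psi) (N (- m)%Z))))].
      * intros x y. rewrite cos_mult, opp_IZR. simpl. do 2 f_equal; f_equal; ring.
      * ring.
    + eapply tp_ext; [| |apply (tp_scal e _ _ (tp_cos n 0 phi (N 0%Z)))].
      * intros x y. simpl. rewrite Rmult_comm. do 2 f_equal. ring.
      * ring.
    + eapply tp_ext; [| |apply (tp_plus _ _ _ _ H1 H2)]; intros; simpl; ring.
    + eapply tp_ext; [| |apply (tp_scal k _ _ H)]; intros; simpl; ring.
    + eapply tp_ext; [| |apply H]; intros; simpl; [now rewrite E|ring].
  - induction Hg as [m psi Hm|e|g1 g2 e1 e2 _ H1 _ H2|k g e _ H|g1 g2 e1 e2 E Ee _ H].
    + assert (N : (0, m)%Z <> (0, 0)%Z) by congruence.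
      eapply tp_ext; [| |apply (tp_scal c _ _ (tp_cos 0 m psi N))].
      * intros x y. simpl. do 2 f_equal. ring.
      * ring.
    + apply tp_const.
    + eapply tp_ext; [| |apply (tp_plus _ _ _ _ H1 H2)]; intros; simpl; ring.
    + eapply tp_ext; [| |apply (tp_scal k _ _ H)]; intros; simpl; ring.
    + eapply tp_ext; [| |apply H]; intros; simpl; [now rewrite E|now rewrite Ee].
  - eapply tp_ext; [| |apply (tp_plus _ _ _ _ H1 H2)]; intros; simpl; ring.
  - eapply tp_ext; [| |apply (tp_scal k _ _ H)]; intros; simpl; ring.
  - eapply tp_ext; [| |apply H]; intros; simpl; [now rewrite E|now rewrite Ec].
Qed.

(** Real part of [exp (i phi)] times the geometric sum of [exp (i k eta)] over [k < m]; the phase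
    [- PI / 2] yields the sine sum. *)
Fixpoint cos_sum (m : nat) (eta phi : R) : R :=
  match m with
  | O => 0
  | S k => cos_sum k eta phi + cos (INR k * eta + phi)
  end.

(** Each summand becomes a difference by [2 sin a cos b = sin (b + a) - sin (b - a)] with
    [a = eta / 2]. *)
Lemma cos_sum_telescope m eta phi :
  2 * sin (eta / 2) * cos_sum m eta phi
  = sin (INR m * eta - eta / 2 + phi) - sin (phi - eta / 2).
Proof.
  induction m as [|m IH].
  - simpl cos_sum. simpl INR. replace (0 * eta - eta / 2 + phi) with (phi - eta / 2) by ring. ring.
  - simpl cos_sum. rewrite Rmult_plus_distr_l, IH, S_INR.
    replace ((INR m + 1) * eta - eta / 2 + phi)
      with ((INR m * eta + phi) + eta / 2) by field.
    replace (INR m * eta - eta / 2 + phi) with ((INR m * eta + phi) - eta / 2) by ring.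
    rewrite sin_plus, (sin_minus (INR m * eta + phi)). ring.
Qed.

(** A bound independent of [m], in product form so that zeros of the sine are allowed. It gives both
    the decay of the Fejer kernel away from its centre and the boundedness of the sums along an
    orbit. *)
Lemma cos_sum_bound m eta phi : Rabs (sin (eta / 2)) * Rabs (cos_sum m eta phi) <= 1.
Proof.
  rewrite <- Rabs_mult.
  replace (sin (eta / 2) * cos_sum m eta phi)
    with (/ 2 * (2 * sin (eta / 2) * cos_sum m eta phi)) by field.
  rewrite cos_sum_telescope. apply Rabs_le.
  pose proof (SIN_bound (INR m * eta - eta / 2 + phi)).
  pose proof (SIN_bound (phi - eta / 2)). lra.
Qed.

(* [m] times the Fejer kernel of order [m]: [|sum_(k < m) exp (i k u)|^2]. *)
Definition fejer (m : nat) (u : R) : R :=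
  cos_sum m u 0 ^ 2 + cos_sum m u (- (PI / 2)) ^ 2.

Lemma fejer_pos m u : 0 <= fejer m u.
Proof. unfold fejer. nra. Qed.

Lemma fejer_away m u : sin (u / 2) ^ 2 * fejer m u <= 2.
Proof.
  unfold fejer. rewrite Rmult_plus_distr_l, <- !Rpow_mult_distr.
  assert (H : forall phi, (sin (u / 2) * cos_sum m u phi) ^ 2 <= 1).
  { intros phi. rewrite <- (pow2_abs (_ * _)), Rabs_mult.
    pose proof (cos_sum_bound m u phi).
    assert (0 <= Rabs (sin (u / 2)) * Rabs (cos_sum m u phi))
      by (apply Rmult_le_pos; apply Rabs_pos).
    nra. }
  pose proof (H 0). pose proof (H (- (PI / 2))). lra.
Qed.

Lemma cos_minus_PI2 x : cos (x + - (PI / 2)) = sin x.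
Proof.
  rewrite cos_plus, cos_neg, sin_neg, cos_PI2, sin_PI2. ring.
Qed.

Lemma trig_poly1_fejer x0 m : trig_poly1 (fun x => fejer m (x - x0)) (INR m).
Proof.
  induction m as [|m IH].
  - eapply tp1_ext; [| |apply (tp1_const 0)]; [|reflexivity].
    intros x. unfold fejer; simpl; ring.
  (* Adding the [m]-th term to a sum changes its squared modulus by twice this cross term plus 1.
     For [k = m] the cross term is the sum of [cos ((m - j) (x - x0))] over [j < m]; all these
     frequencies are nonzero, so its mean is 0. *)
  - assert (C : forall k, (k <= m)%nat -> trig_poly1 (fun x =>
        cos_sum k (x - x0) 0 * cos (INR m * (x - x0))
        + cos_sum k (x - x0) (- (PI / 2)) * sin (INR m * (x - x0))) 0).
    { induction k as [|k IHk]; intros Hk.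
      - eapply tp1_ext; [| |apply (tp1_const 0)]; [|reflexivity].
        intros x. simpl; ring.
      - eapply tp1_ext; [| |apply (tp1_plus _ _ _ _ (IHk ltac:(lia))
          (tp1_cos (Z.of_nat m - Z.of_nat k) (- (INR m - INR k) * x0) ltac:(lia)))].
        + intros x. simpl cos_sum. rewrite cos_minus_PI2, Rplus_0_r, minus_IZR, <- !INR_IZR_INZ.
          replace ((INR m - INR k) * x + - (INR m - INR k) * x0)
            with (INR m * (x - x0) - INR k * (x - x0)) by ring.
          rewrite (cos_minus (INR m * (x - x0))). ring.
        + ring. }
    eapply tp1_ext; [| |apply (tp1_plus _ _ _ _ IH
      (tp1_plus _ _ _ _ (tp1_scal 2 _ _ (C m (le_n m))) (tp1_const 1)))].
    + intros x. unfold fejer. simpl cos_sum. rewrite cos_minus_PI2, Rplus_0_r.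
      pose proof (sin2_cos2 (INR m * (x - x0))) as E. unfold Rsqr in E.
      rewrite <- E. ring.
    + rewrite S_INR. ring.
Qed.

Lemma sin_half_near d u : 0 < d <= PI -> Rabs u <= PI ->
  Rabs u < d \/ sin (d / 2) ^ 2 <= sin (u / 2) ^ 2.
Proof.
  intros Hd Hu. destruct (Rlt_le_dec (Rabs u) d) as [H|H]; [now left|right].
  assert (E : sin (u / 2) ^ 2 = sin (Rabs u / 2) ^ 2).
  { unfold Rabs. destruct Rcase_abs; [|reflexivity].
    replace (- u / 2) with (- (u / 2)) by field. rewrite sin_neg. ring. }
  rewrite E. pose proof PI_RGT_0.
  assert (sin (d / 2) <= sin (Rabs u / 2)) by (apply sin_incr_1; lra).
  assert (0 <= sin (d / 2)) by (apply sin_ge_0; lra).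
  nra.
Qed.

Lemma sin_half_period x z : sin ((x + 2 * PI * IZR z) / 2) ^ 2 = sin (x / 2) ^ 2.
Proof.
  apply (periodic_IZR (fun x => sin (x / 2) ^ 2)). intros t.
  replace ((t + 2 * PI) / 2) with (t / 2 + PI) by field. rewrite neg_sin. ring.
Qed.

(* Fejer concentration without splitting the torus: the pointwise minorant
   [c - C (sin^2 ((x-x0)/2) + sin^2 ((y-y0)/2))] of [H], multiplied by the
   product kernel, dominates a trigonometric polynomial of mean
   [c m^2 - 4 C m]. *)
Lemma trig_poly_localize H x0 y0 :
  torus_fun H -> cont2 H -> 0 < H x0 y0 ->
  exists T T' c d, trig_poly T c /\ trig_poly T' d /\ 0 < d /\
    (forall x y, T' x y <= H x y * T x y).
Proof.
  intros HP HC H0.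
  destruct (torus_fun_bounded H HP HC) as [M HM].
  pose (c := H x0 y0 / 2). assert (Hc : 0 < c) by (unfold c; lra).
  destruct (HC x0 y0 (mkposreal c Hc)) as [d0 Hd0]. simpl in Hd0.
  pose proof PI_RGT_0 as HPI.
  (* The cap [PI] keeps half-angles in the range where the sine increases. *)
  pose (d := Rmin d0 PI).
  assert (Hd : 0 < d <= PI).
  { unfold d. split; [apply Rmin_glb_lt; [apply cond_pos|lra]|apply Rmin_r]. }
  pose (s := sin (d / 2) ^ 2).
  assert (Hs : 0 < s) by (unfold s; apply pow_lt, sin_gt_0; lra).
  assert (HM0 : 0 <= M) by (pose proof (HM x0 y0); pose proof (Rabs_pos (H x0 y0)); lra).
  (* Chosen so that [C * s = c + M]: where one coordinate is at distance at least [d] from the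
     centre modulo [2 * PI], the minorant is at most [- M <= H]. At all nearer points [H > c], since
     [H x0 y0 = 2 * c]. *)
  pose (C := (c + M) / s).
  assert (HC0 : 0 <= C) by (unfold C; apply Rmult_le_pos; [lra|left; now apply Rinv_0_lt_compat]).
  assert (HCs : C * s = c + M) by (unfold C; field; lra).
  assert (Hmin : forall x y,
    c - C * (sin ((x - x0) / 2) ^ 2 + sin ((y - y0) / 2) ^ 2) <= H x y).
  { intros x y.
    destruct (mod_2PI (x - x0)) as [z Hz]. destruct (mod_2PI (y - y0)) as [w Hw].
    rewrite <- (sin_half_period (x - x0) z), <- (sin_half_period (y - y0) w).
    rewrite <- (torus_fun_IZR H HP x y z w).
    set (u := x - x0 + 2 * PI * IZR z) in *. set (v := y - y0 + 2 * PI * IZR w) in *.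
    replace (x + 2 * PI * IZR z) with (x0 + u) by (unfold u; ring).
    replace (y + 2 * PI * IZR w) with (y0 + v) by (unfold v; ring).
    pose proof (HM (x0 + u) (y0 + v)) as B. apply Rabs_le_between in B.
    assert (0 <= sin (u / 2) ^ 2) by nra. assert (0 <= sin (v / 2) ^ 2) by nra.
    destruct (sin_half_near d u Hd Hz) as [Hu|Hu]; fold s in Hu; [|nra].
    destruct (sin_half_near d v Hd Hw) as [Hv|Hv]; fold s in Hv; [|nra].
    assert (A : Rabs (H (x0 + u) (y0 + v) - H x0 y0) < c).
    { pose proof (Rmin_l d0 PI). fold d in H3. apply Hd0.
      - replace (x0 + u - x0) with u by ring; lra.
      - replace (y0 + v - y0) with v by ring; lra. }
    apply Rabs_lt_between in A. unfold c in *. nra. }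
  destruct (nfloor_ex (4 * C / c)) as [k Hk].
  { apply Rmult_le_pos; [lra|left; now apply Rinv_0_lt_compat]. }
  pose (m := S k).
  assert (Hm : 4 * C < c * INR m).
  { unfold m. rewrite S_INR. destruct Hk as [_ Hk].
    apply (Rmult_lt_compat_r c) in Hk; [|lra].
    replace (4 * C / c * c) with (4 * C) in Hk by (field; lra). lra. }
  assert (Hm1 : 0 < INR m) by (unfold m; rewrite S_INR; pose proof (pos_INR k); lra).
  pose (FX := fun x => fejer m (x - x0)). pose (FY := fun y => fejer m (y - y0)).
  pose proof (trig_poly1_fejer x0 m) as TX. fold FX in TX.
  pose proof (trig_poly1_fejer y0 m) as TY. fold FY in TY.
  pose proof (trig_poly1_mult _ _ _ _ TX TY) as TXY.
  pose proof (trig_poly1_mult _ _ _ _ TX (tp1_const 1)) as TX1.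
  pose proof (trig_poly1_mult _ _ _ _ (tp1_const 1) TY) as TY1.
  exists (fun x y => FX x * FY y).
  pose proof (tp_plus _ _ _ _ (tp_scal c _ _ TXY)
    (tp_scal (- (2 * C)) _ _ (tp_plus _ _ _ _ TX1 TY1))) as T'.
  eexists _, _, _. split; [exact TXY|]. split; [exact T'|].
  split; [nra|].
  - intros x y. simpl.
    assert (PX : 0 <= FX x) by apply fejer_pos. assert (PY : 0 <= FY y) by apply fejer_pos.
    assert (AX : sin ((x - x0) / 2) ^ 2 * FX x <= 2) by apply fejer_away.
    assert (AY : sin ((y - y0) / 2) ^ 2 * FY y <= 2) by apply fejer_away.
    pose proof (Rmult_le_compat_r (FX x * FY y) _ _ (Rmult_le_pos _ _ PX PY) (Hmin x y)) as K.
    eapply Rle_trans; [|exact K].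
    set (a := sin ((x - x0) / 2) ^ 2) in *. set (b := sin ((y - y0) / 2) ^ 2) in *.
    (* [fejer_away] trades [a * FX x] for the constant 2, leaving a kernel in one variable, whose
       mean is only [m] against [m^2] for the product. *)
    assert (K1 : C * (a * FX x * FY y) <= C * (2 * FY y)).
    { apply Rmult_le_compat_l; [exact HC0|]. now apply Rmult_le_compat_r. }
    assert (K2 : C * (b * FY y * FX x) <= C * (2 * FX x)).
    { apply Rmult_le_compat_l; [exact HC0|]. now apply Rmult_le_compat_r. }
    nra.
Qed.

(** * Fourier coefficients and periods *)

Lemma cont2_continuous_l f x : cont2 f -> forall y, continuous (fun t => f t y) x.
Proof.
  intros Hf y. apply continuity_pt_filterlim. intros eps He.
  destruct (Hf x y (mkposreal eps He)) as [d Hd].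
  exists d. split; [apply cond_pos|]. intros t [_ Ht]. simpl in Ht. unfold Rdist in Ht.
  simpl. unfold Rdist. apply Hd; [exact Ht|]. rewrite Rminus_diag, Rabs_R0. apply cond_pos.
Qed.

Lemma cont2_continuous_r f x : cont2 f -> forall y, continuous (f x) y.
Proof.
  intros Hf y. apply continuity_pt_filterlim. intros eps He.
  destruct (Hf x y (mkposreal eps He)) as [d Hd].
  exists d. split; [apply cond_pos|]. intros t [_ Ht]. simpl in Ht. unfold Rdist in Ht.
  simpl. unfold Rdist. apply Hd; [|exact Ht]. rewrite Rminus_diag, Rabs_R0. apply cond_pos.
Qed.

Lemma cont2_ex_RInt f x a b : cont2 f -> ex_RInt (f x) a b.
Proof. intros Hf. apply (ex_RInt_continuous (V := R_CompleteNormedModule)). intros z _. now apply cont2_continuous_r. Qed.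

Lemma cont2_RInt_continuous f a b x :
  a <= b -> cont2 f -> continuous (fun t => RInt (f t) a b) x.
Proof.
  intros Hab Hf. apply continuity_pt_filterlim. intros eps He.
  (* The added 1 keeps the denominator positive when [a = b] and makes the final estimate strict. *)
  assert (He' : 0 < eps / (b - a + 1)) by (apply Rdiv_lt_0_compat; lra).
  destruct (uniform_continuity_2d_1d' f a b x (fun y _ => Hf x y) (mkposreal _ He'))
    as [d Hd]. simpl in Hd.
  exists d. split; [apply cond_pos|]. intros t [_ Ht]. simpl in Ht. unfold Rdist in Ht.
  simpl. unfold Rdist.
  rewrite <- (RInt_minus (V := R_CompleteNormedModule)) by now apply cont2_ex_RInt.
  apply Rle_lt_trans with ((b - a) * (eps / (b - a + 1))).
  - apply (abs_RInt_le_const (fun y => f t y - f x y)); [exact Hab| |].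
    + apply (ex_RInt_minus (V := R_NormedModule)); now apply cont2_ex_RInt.
    + intros y Hy. left. apply Rabs_lt_between in Ht.
      pose proof (cond_pos d). apply (Hd y x y t); try lra.
      now rewrite Rminus_diag, Rabs_R0.
  - apply (Rmult_lt_reg_r (b - a + 1)); [lra|]. field_simplify; [|lra]. nra.
Qed.

(** * Integration over the torus and uniqueness of Fourier coefficients *)

Definition torus_int (f : R -> R -> R) : R :=
  RInt (fun x => RInt (fun y => f x y) 0 (2 * PI)) 0 (2 * PI).

Lemma two_PI_pos : 0 < 2 * PI.
Proof. pose proof PI_RGT_0; lra. Qed.

Lemma cont2_ex_RInt2 f a b : cont2 f ->
  ex_RInt (fun x => RInt (fun y => f x y) 0 (2 * PI)) a b.
Proof.
  intros Hf. apply (ex_RInt_continuous (V := R_CompleteNormedModule)). intros z _.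
  apply cont2_RInt_continuous; [left; apply two_PI_pos|exact Hf].
Qed.

Lemma torus_int_ext f g : (forall x y, f x y = g x y) -> torus_int f = torus_int g.
Proof.
  intros E. apply RInt_ext. intros x _. apply RInt_ext. intros y _. apply E.
Qed.

Lemma torus_int_plus f g : cont2 f -> cont2 g ->
  torus_int (fun x y => f x y + g x y) = torus_int f + torus_int g.
Proof.
  intros Hf Hg. unfold torus_int.
  rewrite <- (RInt_plus (V := R_CompleteNormedModule)) by now apply cont2_ex_RInt2.
  apply RInt_ext. intros x _.
  apply (RInt_plus (V := R_CompleteNormedModule)); now apply cont2_ex_RInt.
Qed.

Lemma torus_int_scal k f : cont2 f -> torus_int (fun x y => k * f x y) = k * torus_int f.
Proof.
  intros Hf. unfold torus_int.
  rewrite <- (RInt_scal (V := R_CompleteNormedModule)) by now apply cont2_ex_RInt2.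
  apply RInt_ext. intros x _.
  apply (RInt_scal (V := R_CompleteNormedModule)); now apply cont2_ex_RInt.
Qed.

Lemma torus_int_le f g : cont2 f -> cont2 g -> (forall x y, f x y <= g x y) ->
  torus_int f <= torus_int g.
Proof.
  intros Hf Hg H. pose proof two_PI_pos.
  apply RInt_le; [lra|now apply cont2_ex_RInt2|now apply cont2_ex_RInt2|].
  intros x _. apply RInt_le; [lra|now apply cont2_ex_RInt|now apply cont2_ex_RInt|].
  intros y _. apply H.
Qed.

Lemma torus_int_const c : torus_int (fun _ _ => c) = 4 * PI ^ 2 * c.
Proof.
  unfold torus_int. rewrite !RInt_const. unfold scal; simpl; unfold mult; simpl. ring.
Qed.

Lemma cos_plus_2PI x : cos (x + 2 * PI) = cos x.
Proof. rewrite cos_plus, cos_2PI, sin_2PI. ring. Qed.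

Lemma sin_plus_2PI x : sin (x + 2 * PI) = sin x.
Proof. rewrite sin_plus, cos_2PI, sin_2PI. ring. Qed.

Lemma RInt_cos_period (n : Z) phi : n <> 0%Z ->
  RInt (fun x => cos (IZR n * x + phi)) 0 (2 * PI) = 0.
Proof.
  intros Hn. apply not_0_IZR in Hn.
  apply is_RInt_unique.
  replace 0 with (sin (IZR n * (2 * PI) + phi) / IZR n - sin (IZR n * 0 + phi) / IZR n) at 2.
  - apply (is_RInt_derive (fun x => sin (IZR n * x + phi) / IZR n)).
    + intros x _. auto_derive; [exact I|]. field. exact Hn.
    + intros x _. apply (ex_derive_continuous (V := R_NormedModule)). auto_derive; exact I.
  - replace (IZR n * (2 * PI) + phi) with (IZR n * 0 + phi + 2 * PI * IZR n) by ring.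
    rewrite (periodic_IZR sin (2 * PI)) by apply sin_plus_2PI. ring.
Qed.

Lemma torus_int_cos (n m : Z) phi : (n, m) <> (0, 0)%Z ->
  torus_int (fun x y => cos (IZR n * x + IZR m * y + phi)) = 0.
Proof.
  intros H. unfold torus_int. destruct (Z.eq_dec m 0) as [->|Hm].
  - assert (Hn : n <> 0%Z) by congruence.
    rewrite (RInt_ext _ (fun x => 2 * PI * cos (IZR n * x + phi))).
    + rewrite (RInt_scal (V := R_CompleteNormedModule) (fun x => cos (IZR n * x + phi))).
      * rewrite RInt_cos_period by exact Hn. apply Rmult_0_r.
      * apply (ex_RInt_continuous (V := R_CompleteNormedModule)). intros z _.
        apply (ex_derive_continuous (V := R_NormedModule)). auto_derive; exact I.
    + intros x _. rewrite (RInt_ext _ (fun _ => cos (IZR n * x + phi))).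
      * rewrite RInt_const. unfold scal; simpl; unfold mult; simpl. ring.
      * intros y _. f_equal. ring.
  - rewrite (RInt_ext _ (fun _ => 0)).
    + rewrite RInt_const. apply Rmult_0_r.
    + intros x _. etransitivity; [|apply (RInt_cos_period m (IZR n * x + phi) Hm)].
      apply RInt_ext. intros y _. f_equal. ring.
Qed.

Lemma torus_int_trig_poly f c : trig_poly f c -> torus_int f = 4 * PI ^ 2 * c.
Proof.
  induction 1 as [n m phi H|c|f g c d Hf IHf Hg IHg|k f c Hf IHf|f g c d E <- Hf IHf].
  - rewrite torus_int_cos by exact H. ring.
  - apply torus_int_const.
  - apply trig_poly_cont in Hf, Hg. rewrite torus_int_plus, IHf, IHg by assumption. ring.
  - apply trig_poly_cont in Hf. rewrite torus_int_scal, IHf by assumption. ring.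
  - rewrite <- IHf. symmetry. now apply torus_int_ext.
Qed.

Lemma torus_int_cos_vanish_trig_poly H : cont2 H ->
  (forall n m phi, torus_int (fun x y => H x y * cos (IZR n * x + IZR m * y + phi)) = 0) ->
  forall f c, trig_poly f c -> torus_int (fun x y => H x y * f x y) = 0.
Proof.
  intros HC H0.
  induction 1 as [n m phi _|c|f g c d Hf IHf Hg IHg|k f c Hf IHf|f g c d E _ Hf IHf].
  - apply H0.
  - rewrite (torus_int_ext _ (fun x y => c * (H x y * cos (IZR 0 * x + IZR 0 * y + 0)))).
    + rewrite torus_int_scal, H0; [ring|]. apply cont2_mult; [exact HC|apply cont2_cos].
    + intros x y. replace (IZR 0 * x + IZR 0 * y + 0) with 0 by ring. rewrite cos_0. ring.
  - apply trig_poly_cont in Hf, Hg.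
    rewrite (torus_int_ext _ (fun x y => H x y * f x y + H x y * g x y)) by (intros; ring).
    rewrite torus_int_plus, IHf, IHg by now apply cont2_mult. ring.
  - apply trig_poly_cont in Hf.
    rewrite (torus_int_ext _ (fun x y => k * (H x y * f x y))) by (intros; ring).
    rewrite torus_int_scal, IHf by now apply cont2_mult. ring.
  - rewrite <- IHf. apply torus_int_ext. intros x y. now rewrite E.
Qed.

Lemma torus_fun_opp H : torus_fun H -> torus_fun (fun x y => - H x y).
Proof. intros HP x y. destruct (HP x y) as [-> ->]. split; reflexivity. Qed.

Lemma cont2_opp H : cont2 H -> cont2 (fun x y => - H x y).
Proof. intros HC x y. now apply continuity_2d_pt_opp. Qed.

(** A positive value of [H] would give [0 < 4 PI^2 d <= torus_int (H * T) = 0] through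
    [trig_poly_localize]; applying this to [- H] excludes negative values. *)
Lemma fourier_unique H : torus_fun H -> cont2 H ->
  (forall n m phi, torus_int (fun x y => H x y * cos (IZR n * x + IZR m * y + phi)) = 0) ->
  forall x y, H x y = 0.
Proof.
  assert (Pos : forall K, torus_fun K -> cont2 K ->
    (forall n m phi, torus_int (fun x y => K x y * cos (IZR n * x + IZR m * y + phi)) = 0) ->
    forall x y, K x y <= 0).
  { intros K HP HC H0 x y. apply Rnot_lt_le. intros Hxy.
    destruct (trig_poly_localize K x y HP HC Hxy) as [T [T' [c [d [HT [HT' [Hd Hle]]]]]]].
    pose proof (trig_poly_cont _ _ HT) as CT. pose proof (trig_poly_cont _ _ HT') as CT'.
    pose proof (torus_int_le _ _ CT' (cont2_mult _ _ HC CT) Hle) as L.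
    rewrite (torus_int_cos_vanish_trig_poly K HC H0 _ _ HT) in L.
    rewrite (torus_int_trig_poly _ _ HT') in L.
    pose proof (pow_lt PI 2 PI_RGT_0). nra. }
  intros HP HC H0 x y. apply Rle_antisym; [now apply Pos|].
  assert (- H x y <= 0); [|lra].
  apply (Pos (fun x y => - H x y)); [now apply torus_fun_opp|now apply cont2_opp|].
  intros n m phi.
  rewrite (torus_int_ext _ (fun x y => -1 * (H x y * cos (IZR n * x + IZR m * y + phi))))
    by (intros; ring).
  rewrite torus_int_scal, H0; [ring|]. apply cont2_mult; [exact HC|apply cont2_cos].
Qed.

Lemma RInt_period_shift (g : R -> R) (T v : R) :
  (forall x, continuous g x) -> (forall x, g (x + T) = g x) ->
  RInt (fun x => g (x + v)) 0 T = RInt g 0 T.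
Proof.
  intros HC HP.
  assert (EX : forall a b, ex_RInt g a b).
  { intros a b. apply (ex_RInt_continuous (V := R_CompleteNormedModule)). auto. }
  assert (SH : forall w a b, RInt (fun x => g (x + w)) a b = RInt g (a + w) (b + w)).
  { intros w a b. pose proof (RInt_comp_lin (V := R_CompleteNormedModule) g 1 w a b) as E.
    rewrite !Rmult_1_l in E. rewrite <- (E (EX _ _)). apply RInt_ext.
    intros x _. unfold scal; simpl; unfold mult; simpl. rewrite !Rmult_1_l. reflexivity. }
  rewrite SH, Rplus_0_l.
  (* The interval [[0, T + v]] is cut at [v] and at [T]; by periodicity the pieces [[0, v]] and
     [[T, T + v]] have equal integrals and cancel. *)
  pose proof (RInt_Chasles (V := R_CompleteNormedModule) g 0 v (T + v) (EX _ _) (EX _ _)) as C1.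
  pose proof (RInt_Chasles (V := R_CompleteNormedModule) g 0 T (T + v) (EX _ _) (EX _ _)) as C2.
  pose proof (SH T 0 v) as E. rewrite Rplus_0_l, (Rplus_comm v T) in E.
  rewrite (RInt_ext (fun x => g (x + T)) g) in E by (intros; apply HP).
  unfold plus in C1, C2; simpl in C1, C2. lra.
Qed.

Lemma torus_int_shift f u v : torus_fun f -> cont2 f ->
  torus_int (fun x y => f (x + u) (y + v)) = torus_int f.
Proof.
  intros HP HC. unfold torus_int.
  rewrite (RInt_ext _ (fun x => RInt (fun y => f (x + u) y) 0 (2 * PI))).
  - apply (RInt_period_shift (fun x => RInt (fun y => f x y) 0 (2 * PI))).
    + intros x. apply cont2_RInt_continuous; [left; apply two_PI_pos|exact HC].
    + intros x. apply RInt_ext. intros y _. apply HP.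
  - intros x _. apply (RInt_period_shift (fun y => f (x + u) y)).
    + intros y. now apply cont2_continuous_r.
    + intros y. apply HP.
Qed.

(** * Fourier coefficients in real form, and periods *)

Lemma cos_int_period k x : cos (x + IZR k * (2 * PI)) = cos x.
Proof.
  replace (IZR k * (2 * PI)) with (2 * PI * IZR k) by ring.
  apply (periodic_IZR cos). apply cos_plus_2PI.
Qed.

Lemma torus_fun_cos (n m : Z) phi : torus_fun (fun x y => cos (IZR n * x + IZR m * y + phi)).
Proof.
  intros x y. split.
  - rewrite <- (cos_int_period n (IZR n * x + IZR m * y + phi)). f_equal. ring.
  - rewrite <- (cos_int_period m (IZR n * x + IZR m * y + phi)). f_equal. ring.
Qed.

Lemma torus_fun_mult f g : torus_fun f -> torus_fun g -> torus_fun (fun x y => f x y * g x y).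
Proof.
  intros Hf Hg x y. destruct (Hf x y) as [-> ->], (Hg x y) as [-> ->]. split; reflexivity.
Qed.

(** Up to the factor [4 PI^2], phase 0 gives the real part of the Fourier coefficient and phase
    [PI / 2] the imaginary part, as [cos (t + PI / 2) = - sin t]. The general phase makes room for
    translations. *)
Definition cos_coef (G : R -> R -> R) (n m : Z) (phi : R) : R :=
  torus_int (fun x y => G x y * cos (IZR n * x + IZR m * y + phi)).

Lemma cos_coef_shift G n m phi u v : torus_fun G -> cont2 G ->
  cos_coef (fun x y => G (x + u) (y + v)) n m phi
  = cos_coef G n m (phi - (IZR n * u + IZR m * v)).
Proof.
  intros HP HC. unfold cos_coef.
  rewrite <- (torus_int_shift
    (fun x y => G x y * cos (IZR n * x + IZR m * y + (phi - (IZR n * u + IZR m * v)))) u v).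
  - apply torus_int_ext. intros x y. f_equal. f_equal. ring.
  - apply torus_fun_mult; [exact HP|apply torus_fun_cos].
  - apply cont2_mult; [exact HC|apply cont2_cos].
Qed.

Lemma cos_coef_phase G n m phi : cont2 G ->
  cos_coef G n m phi = cos phi * cos_coef G n m 0 + sin phi * cos_coef G n m (PI / 2).
Proof.
  intros HC. unfold cos_coef.
  assert (HC' : forall psi, cont2 (fun x y => G x y * cos (IZR n * x + IZR m * y + psi))).
  { intros psi. apply cont2_mult; [exact HC|apply cont2_cos]. }
  rewrite <- !torus_int_scal by apply HC'.
  rewrite <- torus_int_plus by (apply (cont2_mult (fun _ _ => _)); [apply cont2_const|apply HC']).
  apply torus_int_ext. intros x y.
  rewrite Rplus_0_r, !cos_plus, cos_PI2, sin_PI2. ring.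
Qed.

Lemma fourier_coef_cos_coef G n m : cont2 G ->
  fourier_coef G n m = (/ (4 * PI ^ 2) * cos_coef G n m 0, / (4 * PI ^ 2) * cos_coef G n m (PI / 2)).
Proof.
  intros HC. unfold fourier_coef.
  assert (C1 : cont2 (fun x y => G x y * cos (IZR n * x + IZR m * y))).
  { apply cont2_mult; [exact HC|]. apply (cont2_ext (fun x y => cos (IZR n * x + IZR m * y + 0))).
    - intros; f_equal; ring.
    - apply cont2_cos. }
  assert (C2 : cont2 (fun x y => G x y * - sin (IZR n * x + IZR m * y))).
  { apply cont2_mult; [exact HC|]. apply (cont2_ext (fun x y => cos (IZR n * x + IZR m * y + PI / 2))).
    - intros. rewrite cos_plus, cos_PI2, sin_PI2. ring.
    - apply cont2_cos. }
  rewrite (is_RInt_unique (V := C_R_CompleteNormedModule) _ _ _ (cos_coef G n m 0, cos_coef G n m (PI / 2))).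
  - reflexivity.
  - assert (E : forall x, RInt (V := C_R_CompleteNormedModule) (fun y => scal (G x y)
          ((cos (IZR n * x + IZR m * y), - sin (IZR n * x + IZR m * y)) : C)) 0 (2 * PI)
        = (RInt (fun y => G x y * cos (IZR n * x + IZR m * y)) 0 (2 * PI),
           RInt (fun y => G x y * - sin (IZR n * x + IZR m * y)) 0 (2 * PI))).
    { intros x. apply (is_RInt_unique (V := C_R_CompleteNormedModule)).
      apply (is_RInt_fct_extend_pair (U := R_NormedModule) (V := R_NormedModule)).
      - apply (RInt_correct (V := R_CompleteNormedModule)).
        apply (cont2_ex_RInt (fun x y => G x y * cos (IZR n * x + IZR m * y)) x); exact C1.
      - apply (RInt_correct (V := R_CompleteNormedModule)).
        apply (cont2_ex_RInt (fun x y => G x y * - sin (IZR n * x + IZR m * y)) x); exact C2. }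
    eapply is_RInt_ext; [intros x _; symmetry; apply E|].
    apply (is_RInt_fct_extend_pair (U := R_NormedModule) (V := R_NormedModule)); simpl.
    + replace (cos_coef G n m 0)
        with (torus_int (fun x y => G x y * cos (IZR n * x + IZR m * y)))
        by (apply torus_int_ext; intros; now rewrite Rplus_0_r).
      apply (RInt_correct (V := R_CompleteNormedModule)).
      exact (cont2_ex_RInt2 _ _ _ C1).
    + replace (cos_coef G n m (PI / 2))
        with (torus_int (fun x y => G x y * - sin (IZR n * x + IZR m * y))).
      * apply (RInt_correct (V := R_CompleteNormedModule)).
        exact (cont2_ex_RInt2 _ _ _ C2).
      * apply torus_int_ext; intros. rewrite cos_plus, cos_PI2, sin_PI2. ring.
Qed.

Definition is_period (G : R -> R -> R) (u v : R) : Prop :=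
  forall x y, G (x + u) (y + v) = G x y.

Definition in_2PIZ (x : R) : Prop := exists k : Z, x = 2 * PI * IZR k.

Lemma cos_eq_1 x : cos x = 1 -> in_2PIZ x.
Proof.
  intros H. replace x with (2 * (x / 2)) in H by field.
  rewrite cos_2a_sin in H.
  destruct (sin_eq_0_0 (x / 2)) as [k Hk]; [nra|].
  exists k. lra.
Qed.

(** Translation by [(u, v)] multiplies the coefficient at [(n, m)] by [exp (i (n u + m v))]. For a
    period this factor is 1 wherever the coefficient is nonzero; conversely, if it is, the translate
    and [G] have equal coefficients and agree by [fourier_unique]. *)
Lemma is_period_iff G u v : torus_fun G -> cont2 G ->
  is_period G u v <->
  forall n m, fourier_support G (n, m) -> in_2PIZ (IZR n * u + IZR m * v).
Proof.
  intros HP HC. split.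
  - intros Hper n m Hs. unfold fourier_support in Hs; simpl in Hs.
    rewrite fourier_coef_cos_coef in Hs by exact HC.
    assert (E : forall phi, cos_coef G n m phi = cos_coef G n m (phi - (IZR n * u + IZR m * v))).
    { intros phi. rewrite <- cos_coef_shift by assumption.
      apply torus_int_ext. intros x y. now rewrite Hper. }
    set (t := IZR n * u + IZR m * v) in *.
    pose proof (E 0) as E0. pose proof (E (PI / 2)) as E1.
    rewrite (cos_coef_phase G n m (0 - t)) in E0 by exact HC.
    rewrite (cos_coef_phase G n m (PI / 2 - t)) in E1 by exact HC.
    rewrite Rminus_0_l, cos_neg, sin_neg in E0. rewrite cos_shift, sin_shift in E1.
    set (A := cos_coef G n m 0) in *. set (B := cos_coef G n m (PI / 2)) in *.
    apply cos_eq_1.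
    (* [E0] and [E1] say that rotation by [t] fixes the vector [(A, B)]; this is their inner product
       with that vector. *)
    assert (Z0 : (A ^ 2 + B ^ 2) * (1 - cos t) = 0).
    { replace ((A ^ 2 + B ^ 2) * (1 - cos t)) with
        (A * (A - (cos t * A + - sin t * B)) + B * (B - (sin t * A + cos t * B))) by ring.
      rewrite <- E0, <- E1. ring. }
    apply Rmult_integral in Z0. destruct Z0 as [Z0|Z0]; [|lra].
    exfalso. apply Hs. assert (A = 0) by nra. assert (B = 0) by nra.
    rewrite H, H0, !Rmult_0_r. reflexivity.
  - intros Hs.
    assert (D0 : forall x y, G (x + u) (y + v) + -1 * G x y = 0).
    { assert (CS : cont2 (fun x y => G (x + u) (y + v))) by now apply cont2_shift.
      assert (CN : cont2 (fun x y => -1 * G x y)).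
      { apply (cont2_mult (fun _ _ => -1)); [apply cont2_const|exact HC]. }
      apply (fourier_unique (fun x y => G (x + u) (y + v) + -1 * G x y)).
      - intros x y. rewrite !(Rplus_comm _ (2 * PI)), !Rplus_assoc, !(Rplus_comm (2 * PI)).
        destruct (HP (x + u) (y + v)) as [-> ->], (HP x y) as [-> ->]. split; reflexivity.
      - now apply cont2_plus.
      - intros n m phi.
        rewrite (torus_int_ext _ (fun x y =>
          G (x + u) (y + v) * cos (IZR n * x + IZR m * y + phi)
          + -1 * (G x y * cos (IZR n * x + IZR m * y + phi)))) by (intros; ring).
        pose proof (cont2_cos (IZR n) (IZR m) phi) as CC.
        rewrite torus_int_plus, torus_int_scal.
        + fold (cos_coef G n m phi). fold (cos_coef (fun x y => G (x + u) (y + v)) n m phi).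
          rewrite cos_coef_shift by assumption.
          (* On the support the phase shift is a multiple of [2 * PI]. Off it the coefficients at
             phases 0 and [PI / 2] vanish, hence at every phase by [cos_coef_phase]. *)
          destruct (classic (fourier_support G (n, m))) as [S|S].
          * destruct (Hs n m S) as [k ->]. unfold cos_coef.
            rewrite (torus_int_ext _ (fun x y => G x y * cos (IZR n * x + IZR m * y + phi))).
            -- ring.
            -- intros x y. rewrite <- (cos_int_period k (_ + (phi - _))).
               f_equal. f_equal. ring.
          * unfold fourier_support in S; simpl in S. apply NNPP in S.
            rewrite fourier_coef_cos_coef in S by exact HC. injection S as S1 S2.
            assert (P : / (4 * PI ^ 2) <> 0).
            { apply Rinv_neq_0_compat. pose proof (pow_lt PI 2 PI_RGT_0). lra. }
            rewrite !(cos_coef_phase G n m (phi - _)), (cos_coef_phase G n m phi) by exact HC.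
            apply Rmult_integral in S1, S2.
            destruct S1 as [|S1]; [contradiction|]. destruct S2 as [|S2]; [contradiction|].
            rewrite S1, S2. ring.
        + now apply cont2_mult.
        + now apply cont2_mult.
        + apply (cont2_mult (fun _ _ => -1)); [apply cont2_const|now apply cont2_mult]. }
    intros x y. specialize (D0 x y). lra.
Qed.

(** * Subgroups of the integer lattice and their annihilators *)

Lemma in_2PIZ_mult k x : in_2PIZ x -> in_2PIZ (IZR k * x).
Proof. intros [j ->]. exists (k * j)%Z. rewrite mult_IZR. ring. Qed.

Lemma in_2PIZ_plus x y : in_2PIZ x -> in_2PIZ y -> in_2PIZ (x + y).
Proof. intros [j ->] [k ->]. exists (j + k)%Z. rewrite plus_IZR. ring. Qed.

Lemma in_2PIZ_0 : in_2PIZ 0.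
Proof. exists 0%Z. ring. Qed.

Lemma in_2PIZ_small x : Rabs x < 2 * PI -> in_2PIZ x -> x = 0.
Proof.
  intros Hx [k ->]. pose proof two_PI_pos.
  rewrite Rabs_mult, (Rabs_pos_eq (2 * PI)) in Hx by lra.
  assert (Hk : Rabs (IZR k) < 1) by nra.
  rewrite <- abs_IZR in Hk. apply lt_IZR in Hk.
  replace k with 0%Z by lia. ring.
Qed.

Lemma in_2PIZ_fraction d : (0 < d)%Z -> in_2PIZ (2 * PI / IZR d) -> d = 1%Z.
Proof.
  intros Hd [k Hk]. pose proof two_PI_pos.
  assert (Hd' : 0 < IZR d) by now apply IZR_lt.
  assert (E : IZR (k * d) = 1).
  { rewrite mult_IZR. apply (Rmult_eq_reg_l (2 * PI)); [|lra].
    rewrite <- Rmult_assoc, <- Hk. field. lra. }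
  apply eq_IZR in E. apply Z.eq_mul_1_nonneg' in E; lia.
Qed.

(** The least positive element, found by descent, divides the others because remainders stay in the
    subgroup; [d = 0] covers the trivial subgroup. *)
Lemma Z_subgroup_principal (P : Z -> Prop) :
  P 0%Z -> (forall a b, P a -> P b -> P (a + b)%Z) -> (forall k a, P a -> P (k * a)%Z) ->
  exists d, (0 <= d)%Z /\ P d /\ forall a, P a -> exists k, a = (k * d)%Z.
Proof.
  intros P0 Padd Pmul.
  destruct (classic (exists n, (0 < n)%Z /\ P n)) as [[n [Hn Pn]]|N].
  - assert (Hn0 : (0 <= n)%Z) by lia. revert Hn Pn. pattern n.
    apply Z_lt_induction; [|exact Hn0].
    clear n Hn0. intros d IH Hd Pd.
    destruct (classic (exists m, (0 < m < d)%Z /\ P m)) as [[m [Hm Pm]]|N].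
    + apply (IH m); auto; lia.
    + exists d. split; [lia|]. split; [exact Pd|]. intros a Pa.
      exists (a / d)%Z. pose proof (Z.div_mod a d ltac:(lia)) as E.
      pose proof (Z.mod_pos_bound a d ltac:(lia)).
      destruct (Z.eq_dec (a mod d) 0) as [Z0|Z0]; [lia|].
      exfalso. apply N. exists (a mod d)%Z. split; [lia|].
      replace (a mod d)%Z with (a + (- (a / d)) * d)%Z by lia.
      apply Padd; auto.
  - exists 0%Z. split; [lia|]. split; [exact P0|]. intros a Pa. exists 0%Z.
    destruct (Z.lt_trichotomy a 0) as [H|[H|H]]; [|lia|].
    + exfalso. apply N. exists (- 1 * a)%Z. split; [lia|auto].
    + exfalso. apply N. exists a. auto.
Qed.

Definition lin_comb (l : list (Z * (Z * Z))) : Z * Z :=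
  fold_right (fun cg acc => (fst acc + fst cg * fst (snd cg),
                             snd acc + fst cg * snd (snd cg))%Z) (0%Z, 0%Z) l.

Lemma lin_comb_cons c a b l : lin_comb ((c, (a, b)) :: l)
  = (fst (lin_comb l) + c * a, snd (lin_comb l) + c * b)%Z.
Proof. reflexivity. Qed.

(** Matches the body of [generates_Z2], so that [generates_Z2 S] is convertible with
    [forall v, span S v]. *)
Definition span (S : Z * Z -> Prop) (v : Z * Z) : Prop :=
  exists l, (forall c g, In (c, g) l -> S g) /\ lin_comb l = v.

Lemma span_zero S : span S (0, 0)%Z.
Proof. exists nil. split; [intros c g []|reflexivity]. Qed.

Lemma span_gen S n m : S (n, m) -> span S (n, m).
Proof.
  intros H. exists ((1%Z, (n, m)) :: nil). split.
  - intros c g [E|[]]. congruence.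
  - rewrite lin_comb_cons. cbn [lin_comb fold_right fst snd]. f_equal; lia.
Qed.

Lemma span_add S a b c d : span S (a, b) -> span S (c, d) -> span S (a + c, b + d)%Z.
Proof.
  intros [l [Hl El]] [l' [Hl' El']]. exists (l ++ l'). split.
  - intros x g H. apply in_app_or in H. destruct H; eauto.
  - revert a b El. clear Hl. induction l as [|[x [n m]] l IH]; intros a b El.
    + injection El as <- <-. exact El'.
    + rewrite lin_comb_cons in El. injection El as <- <-.
      cbn [app]. rewrite lin_comb_cons, (IH _ _ (surjective_pairing _)).
      cbn [fst snd]. f_equal; lia.
Qed.

Lemma span_mul S k a b : span S (a, b) -> span S (k * a, k * b)%Z.
Proof.
  intros [l [Hl El]]. exists (map (fun cg => (k * fst cg, snd cg)%Z) l). split.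
  - intros c g H. apply in_map_iff in H. destruct H as [[c' g'] [E H]].
    injection E as _ <-. eauto.
  - revert a b El. clear Hl. induction l as [|[x [n m]] l IH]; intros a b El.
    + injection El as <- <-. rewrite Z.mul_0_r. reflexivity.
    + rewrite lin_comb_cons in El. injection El as <- <-.
      cbn [map fst snd]. rewrite lin_comb_cons, (IH _ _ (surjective_pairing _)).
      cbn [fst snd]. f_equal; lia.
Qed.

(** The character [(n, m) -> exp (i (n u + m v))] is trivial on [S]. *)
Definition annihilates (S : Z * Z -> Prop) (u v : R) : Prop :=
  forall n m, S (n, m) -> in_2PIZ (IZR n * u + IZR m * v).

Lemma annihilates_span S u v : annihilates S u v -> annihilates (span S) u v.
Proof.
  intros H n m [l [Hl El]]. revert n m El.
  induction l as [|[c [a b]] l IH]; intros n m El.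
  - injection El as <- <-. replace (IZR 0 * u + IZR 0 * v) with 0 by ring. apply in_2PIZ_0.
  - rewrite lin_comb_cons in El. injection El as <- <-.
    rewrite !plus_IZR, !mult_IZR.
    replace (_ + _) with ((IZR (fst (lin_comb l)) * u + IZR (snd (lin_comb l)) * v) + IZR c * (IZR a * u + IZR b * v)) by ring.
    apply in_2PIZ_plus.
    + apply IH; [|apply surjective_pairing]. intros c' g' Hg. apply (Hl c'). now right.
    + apply in_2PIZ_mult, H, (Hl c). now left.
Qed.

(* Pontryagin duality for subgroups of [Z^2], read off a Hermite basis
   [(a, b), (0, d)] of the span. *)
Lemma generates_Z2_iff_annihilator S :
  generates_Z2 S <-> forall u v, annihilates S u v -> in_2PIZ u /\ in_2PIZ v.
Proof.
  split.
  - intros H u v Ha. apply annihilates_span in Ha.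
    pose proof (Ha 1%Z 0%Z (H _)) as E1. pose proof (Ha 0%Z 1%Z (H _)) as E2.
    rewrite Rmult_1_l, Rmult_0_l, Rplus_0_r in E1.
    rewrite Rmult_1_l, Rmult_0_l, Rplus_0_l in E2. now split.
  - intros H.
    destruct (Z_subgroup_principal (fun n => exists m, span S (n, m)))
      as [a [Ha [[b Hab] Hdiv]]].
    { exists 0%Z. apply span_zero. }
    { intros n n' [m Hm] [m' Hm']. eexists. apply span_add; eassumption. }
    { intros k n [m Hm]. eexists. apply span_mul; eassumption. }
    destruct (Z_subgroup_principal (fun m => span S (0, m)%Z)) as [d [Hd [H0d Hdiv']]].
    { apply span_zero. }
    { intros m m' Hm Hm'. apply (span_add S 0 m 0 m'); assumption. }
    { intros k m Hm. pose proof (span_mul S k 0 m Hm) as E. now rewrite Z.mul_0_r in E. }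
    (* A character trivial on the two basis vectors is trivial on [S]. The basis is then tested with
       explicit characters to force [a = d = 1]. *)
    assert (A : forall u v, in_2PIZ (IZR a * u + IZR b * v) -> in_2PIZ (IZR d * v) ->
      in_2PIZ u /\ in_2PIZ v).
    { intros u v Hu Hv. apply H. intros n m Hnm. apply span_gen in Hnm.
      destruct (Hdiv n (ex_intro _ m Hnm)) as [k ->].
      destruct (Hdiv' (m + - k * b)%Z) as [j Hj].
      { pose proof (span_add S _ _ _ _ Hnm (span_mul S (- k) a b Hab)) as E.
        now replace (k * a + - k * a)%Z with 0%Z in E by lia. }
      replace m with (k * b + j * d)%Z by lia.
      rewrite plus_IZR, !mult_IZR.
      replace (_ + _) with (IZR k * (IZR a * u + IZR b * v) + IZR j * (IZR d * v)) by ring.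
      apply in_2PIZ_plus; now apply in_2PIZ_mult. }
    assert (N1 : ~ in_2PIZ 1).
    { intros E. apply in_2PIZ_small in E; [lra|].
      rewrite Rabs_R1. pose proof PI2_1. lra. }
    assert (T : in_2PIZ (2 * PI)) by (exists 1%Z; ring).
    (* The test characters have [v = 0], and [u = 1] if [a = 0] or [u = 2 * PI / a] otherwise. *)
    assert (Ea : a = 1%Z).
    { destruct (Z.eq_dec a 0) as [->|Na].
      - exfalso. apply N1, (A 1 0).
        + replace (_ + _) with 0 by ring. apply in_2PIZ_0.
        + rewrite Rmult_0_r. apply in_2PIZ_0.
      - apply in_2PIZ_fraction; [lia|]. apply (A _ 0).
        + replace (_ + _) with (2 * PI); [exact T|]. field. now apply not_0_IZR.
        + rewrite Rmult_0_r. apply in_2PIZ_0. }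
    (* With [a = 1], the choice [u = - b * v] satisfies the first condition, so [v] can be tested
       alone: [v = 1] if [d = 0], else [v = 2 * PI / d]. *)
    assert (Ed : d = 1%Z).
    { subst a. destruct (Z.eq_dec d 0) as [->|Nd].
      - exfalso. apply N1, (A (- IZR b) 1).
        + replace (_ + _) with 0 by ring. apply in_2PIZ_0.
        + rewrite Rmult_0_l. apply in_2PIZ_0.
      - apply in_2PIZ_fraction; [lia|]. apply (A (- IZR b * (2 * PI / IZR d))).
        + replace (_ + _) with 0 by ring. apply in_2PIZ_0.
        + replace (_ * _) with (2 * PI); [exact T|]. field. now apply not_0_IZR. }
    subst a d. intros [n m].
    pose proof (span_add S _ _ _ _ (span_mul S n _ _ Hab) (span_mul S (m - n * b) _ _ H0d)) as E.
    replace (n * 1 + (m - n * b) * 0)%Z with n in E by lia.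
    replace (n * b + (m - n * b) * 1)%Z with m in E by lia.
    exact E.
Qed.

Lemma generates_Z2_iff_periods G : torus_fun G -> cont2 G ->
  generates_Z2 (fourier_support G) <->
  forall u v, is_period G u v -> in_2PIZ u /\ in_2PIZ v.
Proof.
  intros HP HC. rewrite generates_Z2_iff_annihilator.
  split; intros H u v K; apply H.
  - exact (proj1 (is_period_iff G u v HP HC) K).
  - exact (proj2 (is_period_iff G u v HP HC) K).
Qed.

(** * Nonresonant orbits *)

(** Equivalent to [exp (i (n t1 + m t2)) <> 1] for all nonzero [(n, m)]. The half-angle sine is the
    divisor that [cos_sum_bound] produces. *)
Definition nonresonant (t1 t2 : R) : Prop :=
  forall n m : Z, (n, m) <> (0, 0)%Z -> sin ((IZR n * t1 + IZR m * t2) / 2) <> 0.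

Fixpoint orbit_sum (t1 t2 : R) (f : R -> R -> R) (L : nat) : R :=
  match L with
  | O => 0
  | S k => orbit_sum t1 t2 f k + f (INR k * t1) (INR k * t2)
  end.

Lemma orbit_sum_cos t1 t2 n m phi L :
  orbit_sum t1 t2 (fun x y => cos (n * x + m * y + phi)) L
  = cos_sum L (n * t1 + m * t2) phi.
Proof.
  induction L as [|L IH]; [reflexivity|]. simpl. rewrite IH. do 2 f_equal. ring.
Qed.

(** Weyl equidistribution for trigonometric polynomials: each nonconstant cosine contributes a
    geometric sum bounded uniformly in [L]. *)
Lemma orbit_sum_trig_poly t1 t2 f c : nonresonant t1 t2 -> trig_poly f c ->
  exists B, forall L, Rabs (orbit_sum t1 t2 f L - INR L * c) <= B.
Proof.
  intros Hnr. induction 1 as [n m phi H|c|f g c d _ [B HB] _ [B' HB']|k f c _ [B HB]|f g c d E <- _ [B HB]].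
  - apply Hnr in H. exists (/ Rabs (sin ((IZR n * t1 + IZR m * t2) / 2))). intros L.
    rewrite Rmult_0_r, Rminus_0_r, orbit_sum_cos.
    pose proof (cos_sum_bound L (IZR n * t1 + IZR m * t2) phi) as K.
    apply Rabs_pos_lt in H. apply (Rmult_le_reg_l _ _ _ H).
    rewrite Rinv_r by lra. exact K.
  - exists 0. intros L. replace (orbit_sum t1 t2 (fun _ _ => c) L) with (INR L * c).
    + rewrite Rminus_diag, Rabs_R0. lra.
    + induction L as [|L IH]; [simpl; ring|]. rewrite S_INR. simpl. rewrite <- IH. ring.
  - exists (B + B'). intros L.
    replace (orbit_sum t1 t2 (fun x y => f x y + g x y) L)
      with (orbit_sum t1 t2 f L + orbit_sum t1 t2 g L).
    + replace (_ - _) with ((orbit_sum t1 t2 f L - INR L * c)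
        + (orbit_sum t1 t2 g L - INR L * d)) by ring.
      eapply Rle_trans; [apply Rabs_triang|]. now apply Rplus_le_compat.
    + induction L as [|L IH]; simpl; [ring|]. rewrite <- IH. ring.
  - exists (Rabs k * B). intros L.
    replace (orbit_sum t1 t2 (fun x y => k * f x y) L) with (k * orbit_sum t1 t2 f L).
    + replace (_ - _) with (k * (orbit_sum t1 t2 f L - INR L * c)) by ring.
      rewrite Rabs_mult. apply Rmult_le_compat_l; [apply Rabs_pos|apply HB].
    + induction L as [|L IH]; simpl; [ring|]. rewrite <- IH. ring.
  - exists B. intros L. rewrite <- HB at 1. right. do 2 f_equal. clear -E.
    induction L as [|L IH]; simpl; [reflexivity|]. now rewrite IH, E.
Qed.

(** If [H] were positive somewhere, [T' <= H * T = 0] along the orbit would keep the sums of [T']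
    nonpositive, whereas they are at least [L * d - B] with [d > 0]. *)
Lemma vanish_on_orbit H t1 t2 : nonresonant t1 t2 -> torus_fun H -> cont2 H ->
  (forall k, H (INR k * t1) (INR k * t2) = 0) -> forall x y, H x y = 0.
Proof.
  intros Hnr.
  assert (Pos : forall K, torus_fun K -> cont2 K ->
    (forall k, K (INR k * t1) (INR k * t2) = 0) -> forall x y, K x y <= 0).
  { intros K HP HC H0 x y. apply Rnot_lt_le. intros Hxy.
    destruct (trig_poly_localize K x y HP HC Hxy) as [T [T' [c [d [HT [HT' [Hd Hle]]]]]]].
    destruct (orbit_sum_trig_poly t1 t2 T' d Hnr HT') as [B HB].
    assert (S0 : forall L, orbit_sum t1 t2 T' L <= 0).
    { induction L as [|L IH]; simpl; [lra|].
      pose proof (Hle (INR L * t1) (INR L * t2)) as E. rewrite H0, Rmult_0_l in E. lra. }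
    assert (HB0 : 0 <= B) by (eapply Rle_trans; [apply Rabs_pos|apply (HB O)]).
    destruct (nfloor_ex (B / d)) as [k [_ Hk]].
    { apply Rmult_le_pos; [exact HB0|left; now apply Rinv_0_lt_compat]. }
    specialize (HB (S k)). apply Rabs_le_between in HB. specialize (S0 (S k)).
    rewrite S_INR in HB. apply (Rmult_lt_compat_r d) in Hk; [|exact Hd].
    replace (B / d * d) with B in Hk by (field; lra). lra. }
  intros HP HC H0 x y. apply Rle_antisym; [now apply Pos|].
  assert (- H x y <= 0); [|lra].
  apply (Pos (fun x y => - H x y)); [now apply torus_fun_opp|now apply cont2_opp|].
  intros k. rewrite H0. apply Ropp_0.
Qed.

(** * Choice of a nonresonant time *)

Lemma countable_avoid (u : nat -> R) : exists x, 0 < x /\ forall n, u n <> x.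
Proof.
  (* Cantor's nested intervals. In the second case the right end is the quarter point, strictly
     below the midpoint, so [u n] lies strictly outside the new closed interval in both cases.
     Starting from [(1, 2)] keeps the limit positive. *)
  pose (step := fun n (I : R * R) => let (a, b) := I in
    if Rlt_dec (u n) ((a + b) / 2) then ((a + b) / 2, b) else (a, (3 * a + b) / 4)).
  pose (I := fix I n := match n with O => (1, 2) | S k => step k (I k) end).
  assert (Hlt : forall n, fst (I n) < snd (I n)).
  { induction n as [|n IH]; simpl; [lra|]. destruct (I n) as [a b]. simpl in *.
    destruct Rlt_dec; simpl; lra. }
  assert (Hstep : forall n, fst (I n) <= fst (I (S n)) /\ snd (I (S n)) <= snd (I n) /\
    (u n < fst (I (S n)) \/ snd (I (S n)) < u n)).
  { intros n. specialize (Hlt n). simpl. destruct (I n) as [a b]. simpl in *.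
    destruct Rlt_dec; simpl; lra. }
  assert (Hmono : forall n k, fst (I n) <= fst (I (n + k)%nat) /\ snd (I (n + k)%nat) <= snd (I n)).
  { intros n k. induction k as [|k IH]; [rewrite Nat.add_0_r; lra|].
    rewrite Nat.add_succ_r. destruct (Hstep (n + k)%nat) as [H1 [H2 _]]. lra. }
  assert (Hcross : forall n m, fst (I n) <= snd (I m)).
  { intros n m. destruct (Hmono n m) as [H1 _], (Hmono m n) as [_ H2].
    rewrite (Nat.add_comm m n) in H2. specialize (Hlt (n + m)%nat). lra. }
  destruct (completeness (fun x => exists n, x = fst (I n))) as [c [Hub Hlub]].
  { exists 2. intros x [n ->]. apply (Hcross n O). }
  { exists 1, O. reflexivity. }
  assert (Hl : forall n, fst (I n) <= c) by (intros n; apply Hub; now exists n).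
  assert (Hr : forall n, c <= snd (I n)) by (intros n; apply Hlub; intros x [m ->]; apply Hcross).
  exists c. split.
  - specialize (Hl O). simpl in Hl. lra.
  - intros n E. destruct (Hstep n) as [_ [_ H]]. specialize (Hl (S n)). specialize (Hr (S n)). lra.
Qed.

Definition decode_Z (n : nat) : Z :=
  let (a, b) := Cantor.of_nat n in (Z.of_nat a - Z.of_nat b)%Z.

Lemma decode_Z_surj z : exists n, decode_Z n = z.
Proof.
  exists (Cantor.to_nat (Z.to_nat z, Z.to_nat (- z))).
  unfold decode_Z. rewrite Cantor.cancel_of_to. lia.
Qed.

Lemma irrational_lin_comb alpha beta (n m : Z) : ratio_irrational alpha beta ->
  (n, m) <> (0, 0)%Z -> IZR n * alpha + IZR m * beta <> 0.
Proof.
  intros [Hb Hirr] Hnm E. destruct (Z.eq_dec n 0) as [->|Hn].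
  - assert (Hm : m <> 0%Z) by congruence. apply not_0_IZR in Hm.
    rewrite Rmult_0_l, Rplus_0_l in E. apply Rmult_integral in E. tauto.
  - apply (Hirr (- m)%Z n Hn). rewrite opp_IZR. apply not_0_IZR in Hn.
    apply (Rmult_eq_reg_r (IZR n * beta)); [|now apply Rmult_integral_contrapositive].
    field_simplify; [lra|assumption|assumption].
Qed.

Lemma exists_nonresonant_time alpha beta : ratio_irrational alpha beta ->
  exists tau, 0 < tau /\ nonresonant (alpha * tau) (beta * tau).
Proof.
  intros Hirr.
  (* The index codes a triple [(k, n, m)]; resonance at [(n, m)] means that [tau] equals
     [2 PI k / (n alpha + m beta)] for some [k], with nonzero denominator by irrationality. *)
  destruct (countable_avoid (fun i =>
    let (a, b) := Cantor.of_nat i in let (b1, b2) := Cantor.of_nat b in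
    2 * PI * IZR (decode_Z a) / (IZR (decode_Z b1) * alpha + IZR (decode_Z b2) * beta)))
    as [tau [Ht Hav]].
  exists tau. split; [exact Ht|]. intros n m Hnm Hs.
  apply (irrational_lin_comb alpha beta n m Hirr) in Hnm.
  destruct (sin_eq_0_0 _ Hs) as [k Hk].
  destruct (decode_Z_surj k) as [a Ea], (decode_Z_surj n) as [b1 E1], (decode_Z_surj m) as [b2 E2].
  apply (Hav (Cantor.to_nat (a, Cantor.to_nat (b1, b2)))).
  rewrite !Cantor.cancel_of_to, Ea, E1, E2.
  apply (Rmult_eq_reg_r (IZR n * alpha + IZR m * beta)); [|exact Hnm].
  field_simplify; [lra|exact Hnm].
Qed.

(** * From orbits to finitely many times *)

Record C1 (G : R -> R -> R) : Prop := {
  C1_cont : cont2 G;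
  C1_ex_dx : forall x y, ex_derive (fun t => G t y) x;
  C1_ex_dy : forall x y, ex_derive (fun t => G x t) y;
  C1_cont_dx : cont2 (dx G);
  C1_cont_dy : cont2 (dy G) }.

Lemma smooth2_C1 G : smooth2 G -> C1 G.
Proof.
  assert (E : forall f, (forall p : R * R, continuous (fun q : R * R => f (fst q) (snd q)) p) -> cont2 f).
  { intros f H x y. apply continuity_2d_pt_filterlim. exact (H (x, y)). }
  intros H. destruct (H 1%nat) as [H0 [Hd [Hx Hy]]].
  constructor; try (now apply E); intros x y; apply Hd.
Qed.

Lemma C1_is_derive_line G x y u v s : C1 G ->
  is_derive (fun t => G (x + t * u) (y + t * v)) s
    (dx G (x + s * u) (y + s * v) * u + dy G (x + s * u) (y + s * v) * v).
Proof.
  intros HG. apply is_derive_Reals.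
  apply (derivable_pt_lim_comp_2d G (fun t => x + t * u) (fun t => y + t * v)).
  - apply filterdiff_differentiable_pt_lim.
    apply (is_derive_filterdiff G _ _ (dx G)).
    + apply filter_forall. intros w. apply Derive_correct, (C1_ex_dx G HG).
    + apply Derive_correct, (C1_ex_dy G HG).
    + apply continuity_2d_pt_filterlim, (C1_cont_dx G HG).
  - apply is_derive_Reals. auto_derive; [exact I|ring].
  - apply is_derive_Reals. auto_derive; [exact I|ring].
Qed.

(** [G] has zero derivative along every line of direction [(u, v)], hence is constant on it. *)
Lemma null_direction_period G u v : C1 G ->
  (forall x y, u * dx G x y + v * dy G x y = 0) -> forall s, is_period G (s * u) (s * v).
Proof.
  intros HG H0 s x y.
  destruct (MVT_gen (fun t => G (x + t * u) (y + t * v)) 0 s (fun _ => 0)) as [c [_ Hc]].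
  - intros t _. pose proof (C1_is_derive_line G x y u v t HG) as D.
    assert (E : dx G (x + t * u) (y + t * v) * u + dy G (x + t * u) (y + t * v) * v = 0).
    { rewrite <- (H0 (x + t * u) (y + t * v)). ring. }
    now rewrite E in D.
  - intros t _. apply continuity_pt_filterlim.
    apply (ex_derive_continuous (V := R_NormedModule) (fun t => G (x + t * u) (y + t * v))).
    exact (ex_intro _ _ (C1_is_derive_line G x y u v t HG)).
  - rewrite !Rmult_0_l, !Rplus_0_r in Hc. lra.
Qed.

(** The difference quotients coincide, so the equality holds for arbitrary [f]. *)
Lemma Derive_shift f c x : Derive f (x + c) = Derive (fun t => f (t + c)) x.
Proof.
  unfold Derive. f_equal. apply Lim_ext. intros h. now replace (x + h + c) with (x + c + h) by ring.
Qed.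

Lemma torus_fun_dx G : torus_fun G -> torus_fun (dx G).
Proof.
  intros HP x y. unfold dx. split.
  - rewrite Derive_shift. apply Derive_ext. intros t. apply HP.
  - apply Derive_ext. intros t. apply HP.
Qed.

Lemma torus_fun_dy G : torus_fun G -> torus_fun (dy G).
Proof.
  intros HP x y. unfold dy. split.
  - apply Derive_ext. intros t. apply HP.
  - rewrite Derive_shift. apply Derive_ext. intros t. apply HP.
Qed.

Lemma torus_fun_shift G a b : torus_fun G -> torus_fun (fun x y => G (x + a) (y + b)).
Proof.
  intros HP x y. split.
  - replace (x + 2 * PI + a) with (x + a + 2 * PI) by ring. apply HP.
  - replace (y + 2 * PI + b) with (y + b + 2 * PI) by ring. apply HP.
Qed.

Lemma torus_fun_lin_comb f g a b :
  torus_fun f -> torus_fun g -> torus_fun (fun x y => a * f x y + b * g x y).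
Proof.
  intros Hf Hg x y. destruct (Hf x y) as [-> ->], (Hg x y) as [-> ->]. split; reflexivity.
Qed.

Lemma cont2_lin_comb f g a b : cont2 f -> cont2 g -> cont2 (fun x y => a * f x y + b * g x y).
Proof.
  intros Hf Hg. apply (cont2_plus (fun x y => a * f x y) (fun x y => b * g x y));
    apply (cont2_mult (fun _ _ => _)); try apply cont2_const; assumption.
Qed.

Lemma in_2PIZ_multiples u : (forall s, in_2PIZ (s * u)) -> u = 0.
Proof.
  intros H. apply NNPP. intros Hu. specialize (H (/ u)).
  rewrite Rinv_l in H by exact Hu. apply in_2PIZ_small in H; [lra|].
  rewrite Rabs_R1. pose proof PI2_1. lra.
Qed.

(** Standing hypotheses of the compactness argument; [generic_periods] is what
    [generates_Z2_iff_periods] makes of the support condition. *)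
Record generic (G : R -> R -> R) (t1 t2 : R) : Prop := {
  generic_torus : torus_fun G;
  generic_C1 : C1 G;
  generic_periods : forall u v, is_period G u v -> in_2PIZ u /\ in_2PIZ v;
  generic_times : nonresonant t1 t2 }.

Lemma orbit_period G t1 t2 x y u v : generic G t1 t2 ->
  (forall k, G (x + INR k * t1 + u) (y + INR k * t2 + v) = G (x + INR k * t1) (y + INR k * t2)) ->
  in_2PIZ u /\ in_2PIZ v.
Proof.
  intros [HP HG Hper Hnr] H. apply Hper. intros a b.
  pose proof (C1_cont G HG) as HC.
  (* The base point is absorbed into the function, because [vanish_on_orbit] follows the orbit of
     the origin. *)
  assert (V : forall a b, 1 * G (a + (x + u)) (b + (y + v)) + -1 * G (a + x) (b + y) = 0).
  { apply (vanish_on_orbit _ t1 t2 Hnr).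
    - apply torus_fun_lin_comb; now apply torus_fun_shift.
    - apply cont2_lin_comb; now apply cont2_shift.
    - intros k. specialize (H k).
      replace (INR k * t1 + (x + u)) with (x + INR k * t1 + u) by ring.
      replace (INR k * t2 + (y + v)) with (y + INR k * t2 + v) by ring.
      rewrite H, (Rplus_comm x), (Rplus_comm y). ring. }
  specialize (V (a - x) (b - y)).
  replace (a - x + (x + u)) with (a + u) in V by ring.
  replace (b - y + (y + v)) with (b + v) in V by ring.
  replace (a - x + x) with a in V by ring. replace (b - y + y) with b in V by ring. lra.
Qed.

Lemma orbit_immersive G t1 t2 x y u v : generic G t1 t2 ->
  (forall k, u * dx G (x + INR k * t1) (y + INR k * t2)
           + v * dy G (x + INR k * t1) (y + INR k * t2) = 0) ->
  u = 0 /\ v = 0.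
Proof.
  intros [HP HG Hper Hnr] H.
  assert (V : forall a b, u * dx G (a + x) (b + y) + v * dy G (a + x) (b + y) = 0).
  { apply (vanish_on_orbit _ t1 t2 Hnr).
    - apply torus_fun_lin_comb; apply torus_fun_shift; [now apply torus_fun_dx|now apply torus_fun_dy].
    - apply cont2_lin_comb; apply cont2_shift; apply HG.
    - intros k. rewrite (Rplus_comm _ x), (Rplus_comm _ y). apply H. }
  assert (D : forall s, is_period G (s * u) (s * v)).
  { apply null_direction_period; [exact HG|]. intros a b. specialize (V (a - x) (b - y)).
    replace (a - x + x) with a in V by ring. replace (b - y + y) with b in V by ring. exact V. }
  split; apply in_2PIZ_multiples; intros s; apply (Hper _ _ (D s)).
Qed.

Lemma is_lim_seq_close (w u e : nat -> R) (l : R) :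
  is_lim_seq u l -> is_lim_seq e 0 -> (forall n, Rabs (w n - u n) <= e n) -> is_lim_seq w l.
Proof.
  intros Hu He H.
  apply (is_lim_seq_le_le (fun n => u n - e n) w (fun n => u n + e n)).
  - intros n. specialize (H n). apply Rabs_le_between in H. lra.
  - replace (Finite l) with (Finite (l - 0)) by (f_equal; ring). now apply is_lim_seq_minus'.
  - replace (Finite l) with (Finite (l + 0)) by (f_equal; ring). now apply is_lim_seq_plus'.
Qed.

Lemma is_lim_seq_unique_R u (l l' : R) : is_lim_seq u l -> is_lim_seq u l' -> l = l'.
Proof.
  intros H H'. apply is_lim_seq_unique in H, H'. rewrite H in H'. now injection H'.
Qed.

Lemma is_lim_seq_Rabs_le u (l M : R) :
  (forall n, Rabs (u n) <= M) -> is_lim_seq u l -> Rabs l <= M.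
Proof.
  intros Hu L. apply is_lim_seq_abs in L.
  exact (is_lim_seq_le _ _ _ _ Hu L (is_lim_seq_const M)).
Qed.

Lemma is_lim_seq_plus_const u (l c : R) :
  is_lim_seq u l -> is_lim_seq (fun n => u n + c) (l + c).
Proof. intros H. apply is_lim_seq_plus'; [exact H|apply is_lim_seq_const]. Qed.

(** Directions are scaled to [Rabs a + Rabs b = 1], so a limit direction is nonzero, while by
    continuity it is killed at every point of the limit orbit, against [orbit_immersive]. The
    separate points [w] and [z] accommodate the two mean value points of [C1_mvt]. *)
Lemma no_null_directions G t1 t2 (x y a b e : nat -> R) : generic G t1 t2 ->
  (forall n, Rabs (x n) <= PI) -> (forall n, Rabs (y n) <= PI) ->
  (forall n, ~ (a n = 0 /\ b n = 0)) -> is_lim_seq e 0 ->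
  ~ (forall n k, (k <= n)%nat -> exists w z : R * R,
      (Rabs (fst w - (x n + INR k * t1)) <= e n /\ Rabs (snd w - (y n + INR k * t2)) <= e n) /\
      (Rabs (fst z - (x n + INR k * t1)) <= e n /\ Rabs (snd z - (y n + INR k * t2)) <= e n) /\
      a n * dx G (fst w) (snd w) + b n * dy G (fst z) (snd z) = 0).
Proof.
  intros HG Hx Hy Hab He H.
  pose (r := fun n => Rabs (a n) + Rabs (b n)).
  assert (Hr : forall n, 0 < r n).
  { intros n. unfold r. pose proof (Rabs_pos (a n)). pose proof (Rabs_pos (b n)).
    destruct (Req_dec (a n) 0) as [A|A].
    - assert (B : b n <> 0) by (intros B; now apply (Hab n)). apply Rabs_pos_lt in B. lra.
    - apply Rabs_pos_lt in A. lra. }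
  assert (Hn : forall n, Rabs (a n / r n) + Rabs (b n / r n) = 1).
  { intros n. specialize (Hr n). unfold Rdiv. rewrite !Rabs_mult, (Rabs_pos_eq (/ r n)).
    - rewrite <- Rmult_plus_distr_r. fold (r n). field. lra.
    - left. now apply Rinv_0_lt_compat. }
  destruct (bounded_extract2 x y PI Hx Hy) as [phi [x0 [y0 [Ephi [Lx Ly]]]]].
  destruct (bounded_extract2 (fun n => a (phi n) / r (phi n)) (fun n => b (phi n) / r (phi n)) 1)
    as [psi [u [v [Epsi [Lu Lv]]]]].
  { intros n. specialize (Hn (phi n)). pose proof (Rabs_pos (b (phi n) / r (phi n))). lra. }
  { intros n. specialize (Hn (phi n)). pose proof (Rabs_pos (a (phi n) / r (phi n))). lra. }
  assert (Huv : Rabs u + Rabs v = 1).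
  { apply (is_lim_seq_unique_R (fun n => Rabs (a (phi (psi n)) / r (phi (psi n)))
                                     + Rabs (b (phi (psi n)) / r (phi (psi n))))).
    - apply is_lim_seq_plus'; now apply (is_lim_seq_abs _ (Finite _)).
    - apply (is_lim_seq_ext (fun _ => 1)); [intros n; now rewrite Hn|apply is_lim_seq_const]. }
  destruct (orbit_immersive G t1 t2 x0 y0 u v HG) as [-> ->].
  (* Time [k] is constrained only from index [k] on; shifting by [k] ensures [k <= chi n] for every
     [n]. *)
  - intros k. pose (chi := fun n => phi (psi (n + k)%nat)).
    assert (Ek : extraction (fun n => (n + k)%nat)) by (intros n; lia).
    assert (Epk : extraction (fun n => psi (n + k)%nat)) by now apply extraction_comp.
    assert (Echi : extraction chi) by now apply (extraction_comp phi).
    assert (Hchi : forall n, (k <= chi n)%nat).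
    { intros n. pose proof (extraction_ge _ (extraction_comp _ _ Ephi Epsi) (n + k)%nat).
      unfold chi. simpl in *. lia. }
    destruct (nat_choice _ _ (fun n => H (chi n) k (Hchi n))) as [w Hw].
    destruct (nat_choice _ _ Hw) as [z Hz]. clear Hw.
    pose proof (is_lim_seq_extract e 0 chi Echi He) as Lec.
    pose proof (is_lim_seq_plus_const _ _ (INR k * t1)
      (is_lim_seq_extract _ _ _ Epk Lx)) as Lxc.
    pose proof (is_lim_seq_plus_const _ _ (INR k * t2)
      (is_lim_seq_extract _ _ _ Epk Ly)) as Lyc.
    assert (Lw1 := is_lim_seq_close (fun n => fst (w n)) _ _ _ Lxc Lec (fun n => proj1 (proj1 (Hz n)))).
    assert (Lw2 := is_lim_seq_close (fun n => snd (w n)) _ _ _ Lyc Lec (fun n => proj2 (proj1 (Hz n)))).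
    assert (Lz1 := is_lim_seq_close (fun n => fst (z n)) _ _ _ Lxc Lec (fun n => proj1 (proj1 (proj2 (Hz n))))).
    assert (Lz2 := is_lim_seq_close (fun n => snd (z n)) _ _ _ Lyc Lec (fun n => proj2 (proj1 (proj2 (Hz n))))).
    pose proof (generic_C1 _ _ _ HG) as HC.
    pose proof (cont2_is_lim_seq _ _ _ _ _ (C1_cont_dx G HC) Lw1 Lw2) as Ldx.
    pose proof (cont2_is_lim_seq _ _ _ _ _ (C1_cont_dy G HC) Lz1 Lz2) as Ldy.
    apply (is_lim_seq_extract _ _ _ Ek) in Lu. apply (is_lim_seq_extract _ _ _ Ek) in Lv.
    pose proof (is_lim_seq_plus' _ _ _ _ (is_lim_seq_mult' _ _ _ _ Lu Ldx)
      (is_lim_seq_mult' _ _ _ _ Lv Ldy)) as L.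
    apply (is_lim_seq_unique_R _ _ _ L).
    apply (is_lim_seq_ext (fun _ => 0)); [|apply is_lim_seq_const].
    intros n. fold (chi n). specialize (Hr (chi n)). destruct (Hz n) as [_ [_ E]].
    apply (Rmult_eq_reg_r (r (chi n))); [|lra]. rewrite Rmult_0_l, <- E. field. lra.
  - rewrite Rabs_R0 in Huv. lra.
Qed.

Lemma finitely_immersive G t1 t2 : generic G t1 t2 ->
  exists N, forall x y a b,
    (forall k, (k <= N)%nat -> a * dx G (x + INR k * t1) (y + INR k * t2)
                             + b * dy G (x + INR k * t1) (y + INR k * t2) = 0) ->
    a = 0 /\ b = 0.
Proof.
  intros HG. apply NNPP. intros Hn.
  assert (E : forall n, exists q : (R * R) * (R * R),
    let '((x, y), (a, b)) := q in
    (Rabs x <= PI /\ Rabs y <= PI) /\ ~ (a = 0 /\ b = 0) /\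
    forall k, (k <= n)%nat -> a * dx G (x + INR k * t1) (y + INR k * t2)
                             + b * dy G (x + INR k * t1) (y + INR k * t2) = 0).
  { intros n. apply NNPP. intros H. apply Hn. exists n. intros x y a b Hk.
    apply NNPP. intros Hab. apply H.
    destruct (mod_2PI x) as [z Hz], (mod_2PI y) as [w Hw].
    exists ((x + 2 * PI * IZR z, y + 2 * PI * IZR w), (a, b)).
    split; [now split|]. split; [exact Hab|]. intros k Hkn.
    pose proof (generic_torus _ _ _ HG) as HP.
    replace (x + 2 * PI * IZR z + INR k * t1) with (x + INR k * t1 + 2 * PI * IZR z) by ring.
    replace (y + 2 * PI * IZR w + INR k * t2) with (y + INR k * t2 + 2 * PI * IZR w) by ring.
    rewrite (torus_fun_IZR _ (torus_fun_dx G HP)), (torus_fun_IZR _ (torus_fun_dy G HP)).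
    now apply Hk. }
  apply nat_choice in E. destruct E as [q Hq].
  apply (no_null_directions G t1 t2 (fun n => fst (fst (q n))) (fun n => snd (fst (q n)))
    (fun n => fst (snd (q n))) (fun n => snd (snd (q n))) (fun _ => 0) HG).
  - intros n. specialize (Hq n). destruct (q n) as [[x y] [a b]]. apply Hq.
  - intros n. specialize (Hq n). destruct (q n) as [[x y] [a b]]. apply Hq.
  - intros n. specialize (Hq n). destruct (q n) as [[x y] [a b]]. apply Hq.
  - apply is_lim_seq_const.
  - intros n k Hk. specialize (Hq n). destruct (q n) as [[x y] [a b]]. simpl.
    exists (x + INR k * t1, y + INR k * t2), (x + INR k * t1, y + INR k * t2). simpl.
    rewrite !Rminus_diag, Rabs_R0. repeat split; try apply Rle_refl. now apply Hq.
Qed.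

(** The displacement is split into a vertical step from [(x, y)] to [(x, y + b)] and a horizontal
    one from there, with one mean value point on each. *)
Lemma C1_mvt G x y a b : C1 G -> exists w z : R * R,
  (Rabs (fst w - x) <= Rabs a + Rabs b /\ Rabs (snd w - y) <= Rabs a + Rabs b) /\
  (Rabs (fst z - x) <= Rabs a + Rabs b /\ Rabs (snd z - y) <= Rabs a + Rabs b) /\
  a * dx G (fst w) (snd w) + b * dy G (fst z) (snd z) = G (x + a) (y + b) - G x y.
Proof.
  intros HG.
  assert (B : forall p h c, Rmin p (p + h) <= c <= Rmax p (p + h) -> Rabs (c - p) <= Rabs h).
  { intros p h c. unfold Rmin, Rmax, Rabs. destruct Rle_dec, Rcase_abs, Rcase_abs; lra. }
  destruct (MVT_gen (fun t => G t (y + b)) x (x + a) (fun t => dx G t (y + b))) as [c [Hc Ec]].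
  { intros t _. apply Derive_correct, (C1_ex_dx G HG). }
  { intros t _. apply continuity_pt_filterlim, cont2_continuous_l, HG. }
  destruct (MVT_gen (fun t => G x t) y (y + b) (fun t => dy G x t)) as [d [Hd Ed]].
  { intros t _. apply Derive_correct, (C1_ex_dy G HG). }
  { intros t _. apply continuity_pt_filterlim, cont2_continuous_r, HG. }
  apply B in Hc, Hd. exists (c, y + b), (x, d). simpl.
  pose proof (Rabs_pos a). pose proof (Rabs_pos b).
  replace (y + b - y) with b by ring. rewrite Rminus_diag, Rabs_R0. repeat split; lra.
Qed.

Lemma finitely_injective G t1 t2 : generic G t1 t2 ->
  exists N, forall x y x' y',
    (forall k, (k <= N)%nat -> G (x + INR k * t1) (y + INR k * t2)
                             = G (x' + INR k * t1) (y' + INR k * t2)) ->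
    in_2PIZ (x' - x) /\ in_2PIZ (y' - y).
Proof.
  intros HG. apply NNPP. intros Hn.
  pose proof (generic_torus _ _ _ HG) as HP. pose proof (generic_C1 _ _ _ HG) as HC.
  assert (E : forall n, exists q : (R * R) * (R * R),
    let '((x, y), (a, b)) := q in
    (Rabs x <= PI /\ Rabs y <= PI) /\ (Rabs a <= PI /\ Rabs b <= PI) /\ ~ (a = 0 /\ b = 0) /\
    forall k, (k <= n)%nat -> G (x + INR k * t1 + a) (y + INR k * t2 + b)
                            = G (x + INR k * t1) (y + INR k * t2)).
  { intros n. apply NNPP. intros H. apply Hn. exists n. intros x y x' y' Hk.
    apply NNPP. intros Hab. apply H.
    destruct (mod_2PI x) as [z Hz], (mod_2PI y) as [w Hw].
    destruct (mod_2PI (x' - x)) as [z' Hz'], (mod_2PI (y' - y)) as [w' Hw'].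
    exists ((x + 2 * PI * IZR z, y + 2 * PI * IZR w),
            (x' - x + 2 * PI * IZR z', y' - y + 2 * PI * IZR w')).
    split; [now split|]. split; [now split|]. split.
    - intros [A B]. apply Hab. split.
      + exists (- z')%Z. rewrite opp_IZR. lra.
      + exists (- w')%Z. rewrite opp_IZR. lra.
    - intros k Hkn. specialize (Hk k Hkn).
      replace (x + 2 * PI * IZR z + INR k * t1 + (x' - x + 2 * PI * IZR z'))
        with (x' + INR k * t1 + 2 * PI * IZR (z + z')) by (rewrite plus_IZR; ring).
      replace (y + 2 * PI * IZR w + INR k * t2 + (y' - y + 2 * PI * IZR w'))
        with (y' + INR k * t2 + 2 * PI * IZR (w + w')) by (rewrite plus_IZR; ring).
      replace (x + 2 * PI * IZR z + INR k * t1) with (x + INR k * t1 + 2 * PI * IZR z) by ring.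
      replace (y + 2 * PI * IZR w + INR k * t2) with (y + INR k * t2 + 2 * PI * IZR w) by ring.
      now rewrite !torus_fun_IZR. }
  apply nat_choice in E. destruct E as [q Hq].
  pose (x := fun n => fst (fst (q n))). pose (y := fun n => snd (fst (q n))).
  pose (a := fun n => fst (snd (q n))). pose (b := fun n => snd (snd (q n))).
  assert (K : forall n, (Rabs (x n) <= PI /\ Rabs (y n) <= PI) /\
    (Rabs (a n) <= PI /\ Rabs (b n) <= PI) /\ ~ (a n = 0 /\ b n = 0) /\
    forall k, (k <= n)%nat -> G (x n + INR k * t1 + a n) (y n + INR k * t2 + b n)
                            = G (x n + INR k * t1) (y n + INR k * t2)).
  { intros n. specialize (Hq n). unfold x, y, a, b. destruct (q n) as [[p p'] [d d']]. exact Hq. }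
  clearbody x y a b. clear q Hq.
  destruct (bounded_extract2 x y PI (fun n => proj1 (proj1 (K n))) (fun n => proj2 (proj1 (K n))))
    as [phi [x0 [y0 [Ephi [Lx Ly]]]]].
  destruct (bounded_extract2 (fun n => a (phi n)) (fun n => b (phi n)) PI)
    as [psi [a0 [b0 [Epsi [La Lb]]]]].
  { intros n. apply (K (phi n)). }
  { intros n. apply (K (phi n)). }
  (* The limit displacement is a period, so its coordinates lie in [2 PI Z]; being at most [PI] in
     absolute value, they vanish. Only the diagonal case is left. *)
  assert (Z0 : a0 = 0 /\ b0 = 0).
  { assert (Ba := is_lim_seq_Rabs_le _ _ PI (fun n => proj1 (proj1 (proj2 (K (phi (psi n)))))) La).
    assert (Bb := is_lim_seq_Rabs_le _ _ PI (fun n => proj2 (proj1 (proj2 (K (phi (psi n)))))) Lb).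
    destruct (orbit_period G t1 t2 x0 y0 a0 b0 HG) as [Ha Hb].
    - intros k.
      assert (Ek : extraction (fun n => (n + k)%nat)) by (intros n; lia).
      assert (Epk : extraction (fun n => psi (n + k)%nat)) by now apply extraction_comp.
      pose proof (is_lim_seq_plus_const _ _ (INR k * t1) (is_lim_seq_extract _ _ _ Epk Lx)) as Lx'.
      pose proof (is_lim_seq_plus_const _ _ (INR k * t2) (is_lim_seq_extract _ _ _ Epk Ly)) as Ly'.
      apply (is_lim_seq_extract _ _ _ Ek) in La. apply (is_lim_seq_extract _ _ _ Ek) in Lb.
      pose proof (cont2_is_lim_seq G _ _ _ _ (C1_cont G HC) Lx' Ly') as L1.
      pose proof (cont2_is_lim_seq G _ _ _ _ (C1_cont G HC)
        (is_lim_seq_plus' _ _ _ _ Lx' La) (is_lim_seq_plus' _ _ _ _ Ly' Lb)) as L2.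
      apply (is_lim_seq_unique_R _ _ _ L2).
      eapply is_lim_seq_ext; [|exact L1]. intros n. simpl. symmetry. apply K.
      pose proof (extraction_ge _ (extraction_comp _ _ Ephi Epsi) (n + k)%nat). simpl in *. lia.
    - pose proof PI_RGT_0. split; apply in_2PIZ_small; solve [assumption | lra]. }
  destruct Z0 as [-> ->].
  pose (chi := fun n => phi (psi n)).
  assert (Echi : extraction chi) by now apply (extraction_comp phi).
  (* The displacements themselves serve as directions, and their size, which tends to 0, bounds the
     distance of the mean value points from the orbit. *)
  apply (no_null_directions G t1 t2 (fun n => x (chi n)) (fun n => y (chi n))
    (fun n => a (chi n)) (fun n => b (chi n))
    (fun n => Rabs (a (chi n)) + Rabs (b (chi n))) HG).
  - intros n. apply (K (chi n)).
  - intros n. apply (K (chi n)).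
  - intros n. apply (K (chi n)).
  - replace (Finite 0) with (Finite (Rabs 0 + Rabs 0)) by (f_equal; rewrite Rabs_R0; ring).
    apply is_lim_seq_plus'; now apply (is_lim_seq_abs _ (Finite _)).
  - intros n k Hk.
    destruct (C1_mvt G (x (chi n) + INR k * t1) (y (chi n) + INR k * t2) (a (chi n)) (b (chi n)) HC)
      as [w [z [H1 [H2 H3]]]].
    exists w, z. split; [exact H1|]. split; [exact H2|]. rewrite H3.
    destruct (K (chi n)) as [_ [_ [_ Kn]]]. rewrite Kn; [ring|].
    pose proof (extraction_ge _ Echi n). lia.
Qed.

(** * The Takens map as an embedding, and the equivalence *)

Lemma takens_eq G alpha beta N tau p k :
  takens G alpha beta N tau p k
  = G (fst p + INR k * (alpha * tau)) (snd p + INR k * (beta * tau)).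
Proof. unfold takens, flow. simpl. f_equal; ring. Qed.

Lemma torus_eq_iff p q :
  torus_eq p q <-> in_2PIZ (fst q - fst p) /\ in_2PIZ (snd q - snd p).
Proof.
  split.
  - intros [z [w [-> ->]]]. split; [exists z|exists w]; ring.
  - intros [[z Hz] [w Hw]]. exists z, w. lra.
Qed.

(** A bounded sequence of pairs with 0 as its only cluster point converges to 0. This is how
    compactness yields continuity of the inverse on the image. *)
Lemma is_lim_seq_0_of_subseq (r1 r2 : nat -> R) (M : R) :
  (forall n, Rabs (r1 n) <= M) -> (forall n, Rabs (r2 n) <= M) ->
  (forall phi (l1 l2 : R), filterlim phi eventually eventually ->
     is_lim_seq (fun n => r1 (phi n)) l1 -> is_lim_seq (fun n => r2 (phi n)) l2 ->
     l1 = 0 /\ l2 = 0) ->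
  is_lim_seq r1 0 /\ is_lim_seq r2 0.
Proof.
  intros B1 B2 H.
  assert (C : forall eps : posreal, exists N, forall n, (N <= n)%nat -> Rabs (r1 n) + Rabs (r2 n) < eps).
  { intros eps. apply NNPP. intros Hn.
    assert (E : forall N, exists n, (N <= n)%nat /\ eps <= Rabs (r1 n) + Rabs (r2 n)).
    { intros N. apply NNPP. intros HN. apply Hn. exists N. intros n Hle.
      apply Rnot_le_lt. intros Hlt. apply HN. now exists n. }
    apply nat_choice in E. destruct E as [f Hf].
    destruct (bounded_extract2 (fun n => r1 (f n)) (fun n => r2 (f n)) M)
      as [phi [l1 [l2 [Ephi [L1 L2]]]]]; try (intros n; auto).
    destruct (H (fun n => f (phi n)) l1 l2) as [-> ->]; auto.
    - intros P [N HN]. exists N. intros n Hle. apply HN.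
      pose proof (extraction_ge phi Ephi n). pose proof (proj1 (Hf (phi n))). lia.
    - apply is_lim_seq_abs in L1, L2. simpl in L1, L2. rewrite Rabs_R0 in L1, L2.
      pose proof (is_lim_seq_plus' _ _ _ _ L1 L2) as L. 
      pose proof (is_lim_seq_le _ _ _ _ (fun n => proj2 (Hf (phi n))) (is_lim_seq_const eps) L) as Le.
      simpl in Le. pose proof (cond_pos eps). lra. }
  split; apply is_lim_seq_spec; intros eps; destruct (C eps) as [N HN]; exists N; intros n Hle;
    specialize (HN n Hle); rewrite Rminus_0_r;
    pose proof (Rabs_pos (r1 n)); pose proof (Rabs_pos (r2 n)); lra.
Qed.

Lemma generic_embedding G alpha beta tau : generic G (alpha * tau) (beta * tau) ->
  exists N, (0 < N)%nat /\ torus_smooth_embedding N (takens G alpha beta N tau).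
Proof.
  intros HG. pose proof (generic_torus _ _ _ HG) as HP.
  pose proof (C1_cont _ (generic_C1 _ _ _ HG)) as HC.
  destruct (finitely_injective _ _ _ HG) as [N1 H1].
  destruct (finitely_immersive _ _ _ HG) as [N2 H2].
  pose (N := (N1 + N2 + 1)%nat). exists N. split; [unfold N; lia|].
  assert (Inj : forall p q, (forall k, (k <= N)%nat ->
    takens G alpha beta N tau p k = takens G alpha beta N tau q k) -> torus_eq p q).
  { intros p q H. apply torus_eq_iff, H1. intros k Hk.
    rewrite <- !(takens_eq G alpha beta N tau). apply H. unfold N; lia. }
  split; [exact Inj|split].
  - intros p a b H. apply (H2 (fst p) (snd p)). intros k Hk.
    rewrite <- (H k) by (unfold N; lia). unfold dx, dy. rewrite !Derive_shift.
    f_equal; f_equal; apply Derive_ext; intros t; now rewrite takens_eq.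
  - intros ps p H.
    (* The differences from [p] are reduced to [[-PI, PI]]. A cluster point [(l1, l2)] gives
       [p + (l1, l2)] the same image as [p], so injectivity puts it in [2 PI Z^2], and its size
       makes it 0. *)
    destruct (nat_choice _ _ (fun j => mod_2PI (fst (ps j) - fst p))) as [z1 Hz1].
    destruct (nat_choice _ _ (fun j => mod_2PI (snd (ps j) - snd p))) as [z2 Hz2].
    exists (fun j => (z1 j, z2 j)). simpl.
    destruct (is_lim_seq_0_of_subseq _ _ PI Hz1 Hz2) as [L1 L2].
    + intros phi l1 l2 Hphi L1 L2.
      assert (T : torus_eq p (fst p + l1, snd p + l2)).
      { apply Inj. intros k Hk. rewrite !takens_eq. simpl.
        pose proof (is_lim_seq_subseq _ _ _ Hphi (H k Hk)) as La. rewrite takens_eq in La.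
        apply (is_lim_seq_plus_const _ _ (fst p + INR k * (alpha * tau))) in L1.
        apply (is_lim_seq_plus_const _ _ (snd p + INR k * (beta * tau))) in L2.
        pose proof (cont2_is_lim_seq G _ _ _ _ HC L1 L2) as Lb.
        replace (l1 + (fst p + INR k * (alpha * tau))) with (fst p + l1 + INR k * (alpha * tau)) in Lb by ring.
        replace (l2 + (snd p + INR k * (beta * tau))) with (snd p + l2 + INR k * (beta * tau)) in Lb by ring.
        apply (is_lim_seq_unique_R _ _ _ La).
        eapply is_lim_seq_ext; [|exact Lb]. intros n. simpl. rewrite takens_eq. symmetry.
        rewrite <- (torus_fun_IZR G HP _ _ (z1 (phi n)) (z2 (phi n))). f_equal; ring. }
      apply torus_eq_iff in T. simpl in T.
      replace (fst p + l1 - fst p) with l1 in T by ring.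
      replace (snd p + l2 - snd p) with l2 in T by ring.
      pose proof PI_RGT_0. split; apply in_2PIZ_small; try apply T; apply Rle_lt_trans with PI; try lra.
      * apply (is_lim_seq_Rabs_le _ _ PI (fun n => Hz1 (phi n)) L1).
      * apply (is_lim_seq_Rabs_le _ _ PI (fun n => Hz2 (phi n)) L2).
    + apply (is_lim_seq_plus_const _ _ (fst p)) in L1. rewrite Rplus_0_l in L1.
      apply (is_lim_seq_plus_const _ _ (snd p)) in L2. rewrite Rplus_0_l in L2.
      split; [eapply is_lim_seq_ext; [|exact L1]|eapply is_lim_seq_ext; [|exact L2]];
        intros n; simpl; ring.
Qed.

Theorem theorem2 (alpha beta : R) (G : R -> R -> R) :
  ratio_irrational alpha beta ->
  smooth_torus_fun G ->
  (good_observation G alpha beta <-> generates_Z2 (fourier_support G)).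
Proof.
  intros Hirr [HP HS]. pose proof (smooth2_C1 G HS) as HC.
  rewrite (generates_Z2_iff_periods G HP (C1_cont G HC)). split.
  - intros [N [tau [_ [_ [Inj _]]]]] u v Hper.
    assert (T : torus_eq (0, 0) (u, v)).
    { apply Inj. intros k _. rewrite !takens_eq. simpl.
      rewrite <- Hper. f_equal; ring. }
    apply torus_eq_iff in T. simpl in T. now rewrite !Rminus_0_r in T.
  - intros Hper. destruct (exists_nonresonant_time alpha beta Hirr) as [tau [Ht Hnr]].
    destruct (generic_embedding G alpha beta tau) as [N [HN HE]].
    + now constructor.
    + now exists N, tau.
Qed.
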